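(* $\mathsf{ZP}_\tau\mathsf{CSPACE}[s,c]\subseteq\mathsf{AVG}_\tau\text{-}\mathsf{LCSPACE}[O(s),O(c\log c),o(1)]$.
   Context: Throughout, $n$ is the input length and $s=s(n)$, $c=c(n)$ are non-decreasing logspace-constructible functions with $s\ge\log n$, $s\le c\le 2^s$. A catalytic-type machine has a read-only input tape, a write-only output tape, a read-write work tape and a read-write catalytic tape initially holding an arbitrary string $\tau$. $L\in\mathsf{ZP}_\tau\mathsf{CSPACE}[s,c]$ if some deterministic such machine with work space $s$ and catalytic space $c$ always halts with its initial catalytic content $\tau$ restored, and on every input $x$ outputs either $L(x)$ or a special symbol $\perp$ (never the wrong answer), outputting $L(x)$ for at least half of all initial tapes $\tau\in\{0,1\}^c$. Let $d$ denote Hamming distance. For functions $s',c',e$, $L\in\mathsf{AVG}_\tau\text{-}\mathsf{LCSPACE}[s',c',e]$ if some deterministic such machine with work space $s'$ and catalytic space $c'$ outputs $L(x)$ on every input $x$ and every initial $\tau\in\{0,1\}^{c'}$, and, writing $\tau'$ for its final catalytic content, $\mathbb{E}_\tau[d(\tau,\tau')]\le e$ for $\tau$ uniform in $\{0,1\}^{c'}$. *)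

(* Defs.v *)
From mathcomp Require Import all_boot all_order all_algebra.
Set Implicit Arguments. Unset Strict Implicit. Unset Printing Implicit Defensive.
Import Order.TTheory GRing.Theory Num.Theory.

Inductive move := MoveL | MoveS | MoveR.

Definition mv (d : move) (i len : nat) : nat :=
  match d with
  | MoveL => i.-1
  | MoveS => i
  | MoveR => if i.+1 < len then i.+1 else i
  end.

(* Output alphabet: [Some b] is the bit b, [None] is the special symbol ⊥. *)
Definition outsym := option bool.

(* A deterministic machine with a read-only input tape (binary input, with an
   end-marker [None] at position n), a read-write work tape, a read-write
   catalytic tape, and a write-only output tape. *)
Record TM := {
  tm_state : finType;
  tm_start : tm_state;
  tm_delta : tm_state -> option bool -> bool -> bool ->
             option (tm_state * bool * bool * move * move * move * option outsym)
}.

Record config (M : TM) := Config {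
  cq  : tm_state M;
  ih  : nat;               (* input head position, in 0 .. n *)
  wt  : seq bool;
  wh  : nat;
  ct  : seq bool;
  chd : nat;
  out : seq outsym
}.

Definition read_in (x : seq bool) (i : nat) : option bool :=
  if i < size x then Some (nth false x i) else None.

Definition wr (t : seq bool) (i : nat) (b : bool) : seq bool :=
  if i < size t then set_nth false t i b else t.

Definition step (M : TM) (x : seq bool) (cf : config M) : option (config M) :=
  match tm_delta (cq cf) (read_in x (ih cf)) (nth false (wt cf) (wh cf))
                 (nth false (ct cf) (chd cf)) with
  | None => None
  | Some (q', bw, bc, di, dw, dc, o) =>
      Some (@Config M q' (mv di (ih cf) (size x).+1)
              (wr (wt cf) (wh cf) bw) (mv dw (wh cf) (size (wt cf)))
              (wr (ct cf) (chd cf) bc) (mv dc (chd cf) (size (ct cf)))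
              (if o is Some a then rcons (out cf) a else out cf))
  end.

Fixpoint run (M : TM) (x : seq bool) (k : nat) (cf : config M) : option (config M) :=
  match k with
  | 0 => None
  | k'.+1 => match step x cf with
             | None => Some cf
             | Some cf' => run x k' cf'
             end
  end.

Definition init (M : TM) (x : seq bool) (w : nat) (tau : seq bool) : config M :=
  @Config M (tm_start M) 0 (nseq w false) 0 tau 0 [::].

Definition halts_in (M : TM) (x : seq bool) (w : nat) (tau : seq bool)
    (cf : config M) : Prop :=
  exists k, run x k (init M x w tau) = Some cf.

Arguments init : clear implicits.
Arguments halts_in : clear implicits.

Definition hamming (a b : seq bool) : nat :=
  count id [seq p.1 != p.2 | p <- zip a b].

Definition bits_val (bs : seq bool) : nat :=
  \sum_(i < size bs) nth false bs i * 2 ^ i.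

Definition nondecreasing_nat (f : nat -> nat) : Prop :=
  forall m n, m <= n -> f m <= f n.

Definition logspace_constructible (f : nat -> nat) : Prop :=
  exists (M : TM) (K : nat), forall n, exists (cf : config M) (bs : seq bool),
    halts_in M (nseq n true) (K * (trunc_log 2 n).+1) [::] cf /\
    out cf = map Some bs /\ bits_val bs = f n.

Definition ZPtauCSPACE (s c : nat -> nat) (L : seq bool -> bool) : Prop :=
  exists M : TM, forall x : seq bool,
    (forall tau : (c (size x)).-tuple bool, exists cf : config M,
        halts_in M x (s (size x)) tau cf /\ ct cf = tau /\
        (out cf = [:: Some (L x)] \/ out cf = [:: None])) /\
    (exists S : {set (c (size x)).-tuple bool},
        2 ^ c (size x) <= 2 * #|S| /\
        forall tau, tau \in S -> exists cf : config M,
          halts_in M x (s (size x)) tau cf /\ out cf = [:: Some (L x)]).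

Definition AVGtauLCSPACE (s' c' : nat -> nat) (e : nat -> rat)
    (L : seq bool -> bool) : Prop :=
  exists M : TM, forall x : seq bool,
    exists f : (c' (size x)).-tuple bool -> seq bool,
      (forall tau : (c' (size x)).-tuple bool, exists cf : config M,
          halts_in M x (s' (size x)) tau cf /\ out cf = [:: Some (L x)] /\
          ct cf = f tau) /\
      ((\sum_(tau : (c' (size x)).-tuple bool) (hamming tau (f tau))%:R)
         / (2 ^ c' (size x))%:R <= e (size x))%R.

Definition bigO (f g : nat -> nat) : Prop :=
  exists K N, forall n, N <= n -> f n <= K * g n.

Definition little_o1 (e : nat -> rat) : Prop :=
  forall eps : rat, (0 < eps)%R -> exists N, forall n, N <= n -> (`|e n| <= eps)%R.

(* Main.v *)
(* A run of the given machine restores its catalytic tape, so one may run it on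
   several blocks of a longer catalytic tape one after the other, until a run
   does not answer ⊥.  With [k ~ log c] blocks all of them fail with probability
   about [2 ^ - k]; in this case one block is sacrificed and stepped through all
   of its [2 ^ c] values, which costs at most [c] errors, hence [c * 2 ^ - k] on
   average.  The blocks are interleaved: block [o] consists of the cells
   [o + k * i], so that the block length [c] need not be known and the end of a
   block is met exactly at the end of the tape.  Only [k] must be found, and [k]
   is chosen as the number of binary digits of the tape length. *)
Require Import Defs.
From mathcomp Require Import all_boot all_order all_algebra.
From Stdlib Require Import FunctionalExtensionality.
From mathcomp Require Import zify.
Set Implicit Arguments. Unset Strict Implicit. Unset Printing Implicit Defensive.

(** * Machine fragments *)

(** With [k] just equal to [log c] the average error [c * 2 ^ - k] would only be bounded. The choice
    [k * c < 2 ^ k] gains the missing factor: [k - 1] blocks fail together on a fraction at most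
    [2 ^ - (k - 1)] of the tapes, and [c / 2 ^ (k - 1) < 2 / k]. Stepping through one block ends
    because at least half of all contents, hence at least one, make the given machine answer; no
    answer is ever wrong, so the first one can be printed. The obstacle is that the constructed
    machine is told neither [s], [c] nor [k], and that heads are stopped silently at the ends of the
    tapes. All sizes are read off the tapes: the work tape has [2 * s + 1] cells of six bits, enough
    for the counter and for [k <= 2 * s + 1], and the catalytic tape has [k * c + 1] cells. Only the
    offsets [1] to [k - 1] carry blocks. The cells of offset [0], which include both ends of the
    tape, hold no simulated data; thanks to them every block cell has neighbours on both sides, as
    the test for the end of the tape demands. *)

Record tapes := Tapes {
  t_ih : nat; t_wt : seq bool; t_wh : nat; t_ct : seq bool; t_ch : nat;
  t_out : seq outsym }.

Definition action := (bool * bool * move * move * move * option outsym)%type.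

Definition apply (x : seq bool) (a : action) (t : tapes) : tapes :=
  let '(bw, bc, di, dw, dc, o) := a in
  Tapes (mv di (t_ih t) (size x).+1)
    (wr (t_wt t) (t_wh t) bw) (mv dw (t_wh t) (size (t_wt t)))
    (wr (t_ct t) (t_ch t) bc) (mv dc (t_ch t) (size (t_ct t)))
    (if o is Some b then rcons (t_out t) b else t_out t).

(* A machine fragment leaves its control graph through an exit labelled by a
   value of type [A], so that values read from the tapes can be passed on to
   the next fragment in its finite control. *)
Record frag (A : Type) := Frag {
  pt : finType;
  entry : pt;
  delta : pt -> option bool -> bool -> bool -> action * (pt + A) }.

Definition control (P : finType) (A : Type) :=
  P -> option bool -> bool -> bool -> action * (P + A).

Definition fstep (x : seq bool) P A (d : control P A) (p : P) (t : tapes) :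
    tapes * (P + A) :=
  let r := d p (read_in x (t_ih t)) (nth false (t_wt t) (t_wh t))
             (nth false (t_ct t) (t_ch t)) in
  (apply x r.1 t, r.2).

(** The least such relation, so that a derivation also certifies termination. *)
Inductive reach (x : seq bool) (P : finType) A (d : control P A) :
    P -> tapes -> A -> tapes -> Prop :=
| reach_exit p t a t' : fstep x d p t = (t', inr a) -> reach x d p t a t'
| reach_step p t p1 t1 a t' :
    fstep x d p t = (t1, inl p1) -> reach x d p1 t1 a t' -> reach x d p t a t'.

Definition runs x A (F : frag A) := reach x (@delta _ F) (entry F).

Definition prim A (f : option bool -> bool -> bool -> action * A) : frag A :=
  @Frag A unit tt (fun _ i w c => ((f i w c).1, inr (f i w c).2)).

Definition bind (A : finType) B (F : frag A) (G : A -> frag B) : frag B :=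
  @Frag B (pt F + {a : A & pt (G a)})%type (inl (entry F))
    (fun p i w c => match p with
     | inl p => let r := delta p i w c in
         (r.1, inl (match r.2 with
               | inl p' => inl p'
               | inr a => inr (Tagged (fun a => pt (G a)) (entry (G a)))
               end))
     | inr q => let r := delta (tagged q) i w c in
         (r.1, match r.2 with
               | inl q' => inl (inr (Tagged (fun a => pt (G a)) q'))
               | inr b => inr b
               end)
     end).

Definition loop (A : finType) B (G : A -> frag (A + B)) (a0 : A) : frag B :=
  @Frag B {a : A & pt (G a)} (Tagged (fun a => pt (G a)) (entry (G a0)))
    (fun q i w c => let r := delta (tagged q) i w c in
       (r.1, match r.2 with
             | inl q' => inl (Tagged (fun a => pt (G a)) q')
             | inr (inl a) => inl (Tagged (fun a => pt (G a)) (entry (G a)))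
             | inr (inr b) => inr b
             end)).

Section Rules.
Variable x : seq bool.

Lemma runs_bind (A : finType) B (F : frag A) (G : A -> frag B) t a t1 b t2 :
  runs x F t a t1 -> runs x (G a) t1 b t2 -> runs x (bind F G) t b t2.
Proof.
move=> HF HG.
have {}HG : reach x (@delta _ (bind F G))
    (inr (Tagged (fun a => pt (G a)) (entry (G a)))) t1 b t2.
  move: HG; rewrite /runs; move: (entry (G a)) => p {HF} HG.
  elim: p t1 b t2 / HG => [p s c s' | p s p1 s1 c s']; rewrite /fstep => -[Ht Hd].
    by apply: reach_exit; rewrite /fstep /= Hd Ht.
  by move=> _; apply: reach_step; rewrite /fstep /= Hd Ht.
rewrite /runs /=; move: HF; rewrite /runs.
move: (entry F) => p HF; elim: p t a t1 / HF HG => [p s c s' | p s p1 s1 c s'].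
  by rewrite /fstep => -[Ht Hd]; apply: reach_step; rewrite /fstep /= Hd Ht.
rewrite /fstep => -[Ht Hd] _ IH /IH.
by apply: reach_step; rewrite /fstep /= Hd Ht.
Qed.

(** The transition function of [loop G a0] does not depend on [a0]; so a run of [loop G a1] is also
    a run inside [loop G a0], only from another entry, and can be appended. *)
Lemma reach_loop (A : finType) B (G : A -> frag (A + B)) a0 a t r t1 p :
  reach x (@delta _ (G a)) p t r t1 ->
  (forall b, r = inr b ->
     reach x (@delta _ (loop G a0)) (Tagged (fun a => pt (G a)) p) t b t1) /\
  (forall a1, r = inl a1 -> forall b t2, runs x (loop G a1) t1 b t2 ->
     reach x (@delta _ (loop G a0)) (Tagged (fun a => pt (G a)) p) t b t2).
Proof.
elim: p t r t1 / => [p t c t' | p t p1 t3 c t']; rewrite /fstep => -[Ht Hd].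
  split=> [b Hb|a1 Ha b t2].
    by apply: reach_exit; rewrite /fstep /= Hd Ht Hb.
  by move=> H; apply: reach_step H; rewrite /fstep /= Hd Ht Ha.
move=> _ [IH1 IH2]; split=> [b /IH1|a1 Ha b t2 /(IH2 _ Ha)].
  by apply: reach_step; rewrite /fstep /= Hd Ht.
by apply: reach_step; rewrite /fstep /= Hd Ht.
Qed.

Lemma runs_loop_exit (A : finType) B (G : A -> frag (A + B)) a t b t1 :
  runs x (G a) t (inr b) t1 -> runs x (loop G a) t b t1.
Proof. by move/(reach_loop a) => [+ _] => /(_ _ erefl). Qed.

Lemma runs_loop_next (A : finType) B (G : A -> frag (A + B)) a t a1 t1 b t2 :
  runs x (G a) t (inl a1) t1 -> runs x (loop G a1) t1 b t2 ->
  runs x (loop G a) t b t2.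
Proof. by move/(reach_loop a) => [_ +] => /(_ _ erefl); apply. Qed.

End Rules.

Definition compile (F : frag unit) : TM :=
  @Build_TM (option (pt F)) (Some (entry F))
    (fun p i w c => if p is Some p then
       let: (bw, bc, di, dw, dc, o, r) := delta p i w c in
       Some (if r is inl p' then Some p' else None, bw, bc, di, dw, dc, o)
     else None).

Definition config_of (F : frag unit) (p : option (pt F)) (t : tapes) :
    config (compile F) :=
  @Config (compile F) p (t_ih t) (t_wt t) (t_wh t) (t_ct t) (t_ch t) (t_out t).

Lemma compile_halts (F : frag unit) x w tau t :
  runs x F (Tapes 0 (nseq w false) 0 tau 0 [::]) tt t ->
  halts_in (compile F) x w tau (config_of None t).
Proof.
rewrite /runs /halts_in /init.
rewrite -[Config _ _ _ _ _ _ _]/(config_of (Some (entry F)) (Tapes _ _ _ _ _ _)).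
move: (entry F) (Tapes _ _ _ _ _ _) => p t0; move: tt => u.
elim: p t0 u t / => [p t [] t' | p t p1 t1 [] t']; rewrite /fstep => -[Ht Hd].
  (* Fuel 2: one unit for the exit transition, one for noticing that state [None] has no
     transition. *)
  exists 2 => /=; rewrite /step /=.
  case: delta Ht Hd => [[[[[[bw bc] di] dw] dc] o] r] /= <- -> //.
move=> _ [k IH]; exists k.+1 => /=; rewrite {1}/step /=.
case: delta Ht Hd => [[[[[[bw bc] di] dw] dc] o] r] /= Ht Hr.
by rewrite Hr; move: IH; rewrite -Ht /config_of /=.
Qed.

(** * Elementary fragments *)

Notation "'get' v := F 'in' G" := (bind F (fun v => G))
  (at level 200, v name, F at level 99, G at level 200).
Notation "F ;; G" := (bind F (fun _ => G)) (at level 100, right associativity).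

#[global] Arguments bind : simpl never.
#[global] Arguments loop : simpl never.
#[global] Arguments prim : simpl never.

Definition ret A (a : A) : frag A :=
  prim (fun _ w c => ((w, c, MoveS, MoveS, MoveS, None), a)).
Definition read_input : frag (option bool) :=
  prim (fun i w c => ((w, c, MoveS, MoveS, MoveS, None), i)).
Definition read_work : frag bool :=
  prim (fun i w c => ((w, c, MoveS, MoveS, MoveS, None), w)).
Definition read_cat : frag bool :=
  prim (fun i w c => ((w, c, MoveS, MoveS, MoveS, None), c)).
Definition write_work b : frag unit :=
  prim (fun i w c => ((b, c, MoveS, MoveS, MoveS, None), tt)).
Definition write_cat b : frag unit :=
  prim (fun i w c => ((w, b, MoveS, MoveS, MoveS, None), tt)).
Definition move_input d : frag unit :=
  prim (fun i w c => ((w, c, d, MoveS, MoveS, None), tt)).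
Definition move_work d : frag unit :=
  prim (fun i w c => ((w, c, MoveS, d, MoveS, None), tt)).
Definition move_cat d : frag unit :=
  prim (fun i w c => ((w, c, MoveS, MoveS, d, None), tt)).
Definition emit o : frag unit :=
  prim (fun i w c => ((w, c, MoveS, MoveS, MoveS, Some o), tt)).

Lemma size_wr t i b : size (wr t i b) = size t.
Proof. by rewrite /wr; case: ltnP => // H; rewrite size_set_nth; lia. Qed.

Lemma nth_wr t i b j :
  nth false (wr t i b) j = if (j == i) && (i < size t) then b else nth false t j.
Proof.
rewrite /wr; case: ltnP => H; last by rewrite andbF.
by rewrite nth_set_nth /= andbT.
Qed.

Lemma wr_nth t i : wr t i (nth false t i) = t.
Proof.
apply: (@eq_from_nth _ false); first exact: size_wr.
by move=> j _; rewrite nth_wr; case: andP => // -[/eqP ->].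
Qed.

Section Primitives.
Variable x : seq bool.
Implicit Types (ih wh ch : nat) (wt ct : seq bool) (o : seq outsym).

Lemma runs_ret A (a : A) t : runs x (ret a) t a t.
Proof.
by case: t => ih wt wh ct ch o; apply: reach_exit; rewrite /fstep /= !wr_nth.
Qed.

Lemma runs_read_input ih wt wh ct ch o :
  runs x read_input (Tapes ih wt wh ct ch o) (read_in x ih) (Tapes ih wt wh ct ch o).
Proof. by apply: reach_exit; rewrite /fstep /= !wr_nth. Qed.

Lemma runs_read_work ih wt wh ct ch o :
  runs x read_work (Tapes ih wt wh ct ch o) (nth false wt wh) (Tapes ih wt wh ct ch o).
Proof. by apply: reach_exit; rewrite /fstep /= !wr_nth. Qed.

Lemma runs_read_cat ih wt wh ct ch o :
  runs x read_cat (Tapes ih wt wh ct ch o) (nth false ct ch) (Tapes ih wt wh ct ch o).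
Proof. by apply: reach_exit; rewrite /fstep /= !wr_nth. Qed.

Lemma runs_write_work b ih wt wh ct ch o :
  runs x (write_work b) (Tapes ih wt wh ct ch o) tt (Tapes ih (wr wt wh b) wh ct ch o).
Proof. by apply: reach_exit; rewrite /fstep /= wr_nth. Qed.

Lemma runs_write_cat b ih wt wh ct ch o :
  runs x (write_cat b) (Tapes ih wt wh ct ch o) tt (Tapes ih wt wh (wr ct ch b) ch o).
Proof. by apply: reach_exit; rewrite /fstep /= wr_nth. Qed.

Lemma runs_move_input d ih wt wh ct ch o :
  runs x (move_input d) (Tapes ih wt wh ct ch o) tt
    (Tapes (mv d ih (size x).+1) wt wh ct ch o).
Proof. by apply: reach_exit; rewrite /fstep /= !wr_nth. Qed.

Lemma runs_move_work d ih wt wh ct ch o :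
  runs x (move_work d) (Tapes ih wt wh ct ch o) tt
    (Tapes ih wt (mv d wh (size wt)) ct ch o).
Proof. by apply: reach_exit; rewrite /fstep /= !wr_nth. Qed.

Lemma runs_move_cat d ih wt wh ct ch o :
  runs x (move_cat d) (Tapes ih wt wh ct ch o) tt
    (Tapes ih wt wh ct (mv d ch (size ct)) o).
Proof. by apply: reach_exit; rewrite /fstep /= !wr_nth. Qed.

Lemma runs_emit b ih wt wh ct ch o :
  runs x (emit b) (Tapes ih wt wh ct ch o) tt (Tapes ih wt wh ct ch (rcons o b)).
Proof. by apply: reach_exit; rewrite /fstep /= !wr_nth. Qed.

End Primitives.

Definition flip d := match d with MoveL => MoveR | MoveS => MoveS | MoveR => MoveL end.

(* Nothing on a catalytic tape can be recognised, so the end of the tape is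
   detected by overwriting two neighbouring cells q, p (with p = q + d) by 0, 1:
   after a move by d and one back, the head reads 1 if the first of them moved,
   and 0 if it was blocked.  Moving by d first would be wrong: the tape may be
   such that this merges two different configurations. *)
Definition detect d : frag bool :=
  get v := read_cat in move_cat (flip d) ;;
  get u := read_cat in write_cat false ;; move_cat d ;;
  write_cat true ;; move_cat d ;; move_cat (flip d) ;;
  get f := read_cat in
  if f then write_cat v ;; move_cat (flip d) ;; write_cat u ;;
            move_cat d ;; move_cat d ;; ret true
  else write_cat u ;; move_cat d ;; write_cat v ;; ret false.

(** A blocked move is expressed by [p' = p], so that one statement covers both directions and both
    outcomes. The two branches restore the cells in different orders because the head ends on
    different cells. *)
Lemma runs_detect x d ih wt wh ct p o q p' :
  mv (flip d) p (size ct) = q -> mv d p (size ct) = p' ->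
  q < size ct -> p < size ct -> q != p -> mv d q (size ct) = p ->
  (p' != p -> mv (flip d) p' (size ct) = p) ->
  runs x (detect d) (Tapes ih wt wh ct p o) (p' != p) (Tapes ih wt wh ct p' o).
Proof.
move=> q_def p'_def qlt plt qp dq dp'.
apply: runs_bind; first exact: runs_read_cat.
apply: runs_bind; first exact: runs_move_cat.
apply: runs_bind; first exact: runs_read_cat.
apply: runs_bind; first exact: runs_write_cat.
apply: runs_bind; first exact: runs_move_cat.
rewrite size_wr q_def dq.
apply: runs_bind; first exact: runs_write_cat.
apply: runs_bind; first exact: runs_move_cat.
rewrite !size_wr p'_def.
apply: runs_bind; first exact: runs_move_cat.
rewrite !size_wr.
apply: runs_bind; first exact: runs_read_cat.
have pq : (p == q) = false by apply/eqP => E; rewrite E eqxx in qp.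
case: (altP (p' =P p)) => [p'p|p'p].
  have -> : mv (flip d) p' (size ct) = q by rewrite p'p.
  rewrite !nth_wr (negPf qp) eqxx qlt /=.
  apply: runs_bind; first exact: runs_write_cat.
  apply: runs_bind; first exact: runs_move_cat.
  rewrite !size_wr dq.
  apply: runs_bind; first exact: runs_write_cat.
  have -> : wr (wr (wr (wr ct q false) p true) q (nth false ct q)) p (nth false ct p) = ct.
    apply: (@eq_from_nth _ false); first by rewrite !size_wr.
    move=> j _; rewrite !nth_wr !size_wr.
    case: (altP (j =P p)) => [->|_] /=; first by rewrite plt.
    by case: (altP (j =P q)) => [->|_] /=; rewrite ?qlt.
  by rewrite p'p; apply: runs_ret.
rewrite (dp' p'p) !nth_wr eqxx size_wr plt /=.
apply: runs_bind; first exact: runs_write_cat.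
apply: runs_bind; first exact: runs_move_cat.
rewrite !size_wr q_def.
apply: runs_bind; first exact: runs_write_cat.
have -> : wr (wr (wr (wr ct q false) p true) p (nth false ct p)) q (nth false ct q) = ct.
  apply: (@eq_from_nth _ false); first by rewrite !size_wr.
  move=> j _; rewrite !nth_wr !size_wr.
  case: (altP (j =P q)) => [->|_] /=; first by rewrite qlt.
  by case: (altP (j =P p)) => [->|_] /=; rewrite ?plt.
apply: runs_bind; first exact: runs_move_cat.
rewrite dq.
apply: runs_bind; first exact: runs_move_cat.
rewrite p'_def; exact: runs_ret.
Qed.

Lemma runs_detectR x ih wt wh ct p o : 0 < p < size ct ->
  runs x (detect MoveR) (Tapes ih wt wh ct p o) (p.+1 < size ct)
    (Tapes ih wt wh ct (if p.+1 < size ct then p.+1 else p) o).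
Proof.
move=> Hp; set p' := if _ then _ else _.
have -> : (p.+1 < size ct) = (p' != p).
  by rewrite /p'; case: ltnP => _; rewrite ?eqxx //; apply/esym/eqP; lia.
apply: (@runs_detect x MoveR _ _ _ _ _ _ p.-1); rewrite /flip /mv //; try lia.
  by case: ltnP; lia.
by rewrite /p'; case: ltnP; lia.
Qed.

Lemma runs_detectL x ih wt wh ct p o : p.+1 < size ct ->
  runs x (detect MoveL) (Tapes ih wt wh ct p o) (0 < p) (Tapes ih wt wh ct p.-1 o).
Proof.
move=> Hp; have -> : (0 < p) = (p.-1 != p) by lia.
apply: (@runs_detect x MoveL _ _ _ _ _ _ p.+1); rewrite /flip /mv ?Hp //; try lia.
by move=> ?; case: ltnP; lia.
Qed.

(** * Tracks on the work tape *)

(* The work tape is divided into blocks of six bits; bit [r] of every block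
   belongs to track [r]. *)
Definition START := 0. Definition DATA := 1. Definition HEAD := 2.
Definition COUNT := 3. Definition STRIDE := 4. Definition END := 5.

Definition tracks (N : nat) (T : nat -> nat -> bool) : seq bool :=
  mkseq (fun p => T (p %/ 6) (p %% 6)) (6 * N).

Definition upd (T : nat -> nat -> bool) i r b : nat -> nat -> bool :=
  fun i' r' => if (i' == i) && (r' == r) then b else T i' r'.

Fixpoint steps_work d n : frag unit :=
  if n is n'.+1 then move_work d ;; steps_work d n' else ret tt.

Definition cell_left := steps_work MoveL 6.
Definition cell_right := steps_work MoveR 6.

Definition get_track r : frag bool :=
  steps_work MoveR r ;; get b := read_work in steps_work MoveL r ;; ret b.

Definition set_track r b : frag unit :=
  steps_work MoveR r ;; write_work b ;; steps_work MoveL r.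

(** The output is empty here because the answer is printed only at the very end. *)
Definition cells N ih T i ct ch := Tapes ih (tracks N T) (6 * i) ct ch [::].

(** From cell [i], [body] is executed in the cells [i - 1] down to [0], hence exactly as often as
    the head had moved to the right from the start. The work head thus serves as a loop counter that
    can be undone. *)
Definition sweep_left (body : frag unit) : frag unit :=
  loop (fun _ : unit => get s := get_track START in
        if s then ret (inr tt) else cell_left ;; body ;; ret (inl tt)) tt.

Definition home : frag unit := sweep_left (ret tt).

(* [stride d] moves the catalytic head by as many cells as the mark on track
   [STRIDE] says, and not at all if this crosses an end of the tape. *)
Definition stride d : frag bool :=
  get r := loop (fun _ : unit =>
    get f := detect d in
    if f then get m := get_track STRIDE in
              if m then ret (inr true) else cell_right ;; ret (inl tt)
    else ret (inr false)) tt in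
  sweep_left (if r then ret tt else move_cat (flip d)) ;; ret r.

(* Increments ([b = false]) or decrements ([b = true]) the binary counter on
   track [COUNT] by locating its lowest digit [b]; fails if there is none. *)
Definition tick b : frag bool :=
  get r := loop (fun _ : unit =>
    get p := get_track COUNT in
    if p == b then set_track COUNT (~~ b) ;; ret (inr true)
    else get e := get_track END in
         if e then ret (inr false) else cell_right ;; ret (inl tt)) tt in
  sweep_left (if r then set_track COUNT b else ret tt) ;; ret r.

Section Tracks.
Variables (x : seq bool) (N : nat).
Implicit Types (T : nat -> nat -> bool) (ih i r : nat) (ct : seq bool).

Lemma size_tracks T : size (tracks N T) = 6 * N.
Proof. exact: size_mkseq. Qed.

Lemma nth_tracks T i r : i < N -> r < 6 -> nth false (tracks N T) (6 * i + r) = T i r.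
Proof. by move=> iN r6; rewrite nth_mkseq; [congr (T _ _); lia | lia]. Qed.

Lemma wr_tracks T i r b : i < N -> r < 6 ->
  wr (tracks N T) (6 * i + r) b = tracks N (upd T i r b).
Proof.
move=> iN r6; apply: (@eq_from_nth _ false); first by rewrite size_wr !size_tracks.
move=> j; rewrite size_wr size_tracks => jN.
rewrite nth_wr size_tracks !nth_mkseq // /upd.
have -> : 6 * i + r < 6 * N by lia.
rewrite andbT; congr (if _ then _ else _); lia.
Qed.

Lemma steps_workR n ih wt wh ct ch o : wh + n < size wt ->
  runs x (steps_work MoveR n) (Tapes ih wt wh ct ch o) tt (Tapes ih wt (wh + n) ct ch o).
Proof.
elim: n wh => [|n IH] wh H; first by rewrite addn0; apply: runs_ret.
apply: runs_bind; first exact: runs_move_work.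
rewrite /= ifT; last by lia.
by rewrite -addSnnS; apply: IH; lia.
Qed.

Lemma steps_workL n ih wt wh ct ch o :
  runs x (steps_work MoveL n) (Tapes ih wt wh ct ch o) tt (Tapes ih wt (wh - n) ct ch o).
Proof.
elim: n wh => [|n IH] wh; first by rewrite subn0; apply: runs_ret.
apply: runs_bind; first exact: runs_move_work.
by rewrite /= (_ : wh - n.+1 = wh.-1 - n); [exact: IH | lia].
Qed.

Lemma runs_cell_left ih T i ct ch :
  runs x cell_left (cells N ih T i.+1 ct ch) tt (cells N ih T i ct ch).
Proof.
by rewrite [X in runs _ _ _ _ X]/cells (_ : 6 * i = 6 * i.+1 - 6); [exact: steps_workL | lia].
Qed.

Lemma runs_cell_right ih T i ct ch : i.+1 < N ->
  runs x cell_right (cells N ih T i ct ch) tt (cells N ih T i.+1 ct ch).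
Proof.
move=> H; rewrite [X in runs _ _ _ _ X]/cells (_ : 6 * i.+1 = 6 * i + 6); last by lia.
by apply: steps_workR; rewrite size_tracks; lia.
Qed.

Lemma runs_get_track ih T i r ct ch : i < N -> r < 6 ->
  runs x (get_track r) (cells N ih T i ct ch) (T i r) (cells N ih T i ct ch).
Proof.
move=> iN r6; apply: runs_bind.
  by apply: steps_workR; rewrite size_tracks; lia.
apply: runs_bind; first exact: runs_read_work.
apply: runs_bind; first exact: steps_workL.
rewrite nth_tracks // addnK; exact: runs_ret.
Qed.

Lemma runs_set_track ih T i r b ct ch : i < N -> r < 6 ->
  runs x (set_track r b) (cells N ih T i ct ch) tt (cells N ih (upd T i r b) i ct ch).
Proof.
move=> iN r6; apply: runs_bind.
  by apply: steps_workR; rewrite size_tracks; lia.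
apply: runs_bind; first exact: runs_write_work.
rewrite wr_tracks //.
by rewrite [X in runs _ _ _ _ X]/cells -{2}(addnK r (6 * i)); apply: steps_workL.
Qed.

Lemma runs_sweep_left body (ih : nat) (T : nat -> nat -> nat -> bool)
    (ct : nat -> seq bool) (ch : nat -> nat) i : i < N ->
  (forall j, j <= i -> T j j START = (j == 0)) ->
  (forall j, j < i ->
     runs x body (cells N ih (T j.+1) j (ct j.+1) (ch j.+1)) tt
                 (cells N ih (T j) j (ct j) (ch j))) ->
  runs x (sweep_left body) (cells N ih (T i) i (ct i) (ch i)) tt
                 (cells N ih (T 0) 0 (ct 0) (ch 0)).
Proof.
elim: i => [|i IH] iN HS Hb.
  apply: runs_loop_exit; apply: runs_bind; first exact: runs_get_track.
  by rewrite HS //; apply: runs_ret.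
apply: runs_loop_next.
  apply: runs_bind; first exact: runs_get_track.
  rewrite HS //; apply: runs_bind; first exact: runs_cell_left.
  by apply: runs_bind; [apply: Hb | apply: runs_ret].
by apply: IH => [|j ji|j ji]; [lia | apply: HS; lia | apply: Hb; lia].
Qed.

Lemma runs_home ih T ct ch i : i < N -> (forall j, j <= i -> T j START = (j == 0)) ->
  runs x home (cells N ih T i ct ch) tt (cells N ih T 0 ct ch).
Proof.
move=> iN HS.
apply: (runs_sweep_left (T := fun _ => T) (ct := fun _ => ct) (ch := fun _ => ch)) => //.
by move=> j _; apply: runs_ret.
Qed.

Section Stride.
Variables (ih : nat) (T : nat -> nat -> bool) (k : nat) (ct : seq bool).
Hypotheses (k_gt0 : 0 < k) (kN : k <= N).
Hypothesis T_start : forall j, j < N -> T j START = (j == 0).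
Hypothesis T_stride : forall j, j < N -> T j STRIDE = (j == k.-1).

(** The work head counts the moves: in cell [m] the move from [P m] to [P m.+1] is made, so the mark
    in cell [k - 1] stops the loop after exactly [k] moves. *)
Lemma runs_stride_full d (P : nat -> nat) :
  (forall m i, m < k -> runs x (detect d) (cells N ih T i ct (P m)) true
                                          (cells N ih T i ct (P m.+1))) ->
  runs x (stride d) (cells N ih T 0 ct (P 0)) true (cells N ih T 0 ct (P k)).
Proof.
move=> HP; apply: (@runs_bind _ _ _ _ _ _ true (cells N ih T k.-1 ct (P k))).
  have H m : m < k -> runs x (loop (fun _ : unit =>
    get f := detect d in
    if f then get m := get_track STRIDE in
              if m then ret (inr true) else cell_right ;; ret (inl tt)
    else ret (inr false)) tt) (cells N ih T (k.-1 - m) ct (P (k.-1 - m))) true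
      (cells N ih T k.-1 ct (P k)).
    elim: m => [|m IH] mk.
      apply: runs_loop_exit; apply: runs_bind; first by apply: HP; lia.
      apply: runs_bind; first by apply: runs_get_track => //; lia.
      rewrite T_stride ?subn0 ?eqxx ?prednK //; exact: runs_ret.
    apply: runs_loop_next; last by apply: IH; lia.
    apply: runs_bind; first by apply: HP; lia.
    apply: runs_bind; first by apply: runs_get_track => //; lia.
    rewrite T_stride; last by lia.
    rewrite ifF; last by lia.
    rewrite (_ : k.-1 - m = (k.-1 - m.+1).+1); last by lia.
    by apply: runs_bind; [apply: runs_cell_right; lia | apply: runs_ret].
  by move: (H k.-1); rewrite subnn; apply; lia.
apply: runs_bind; last exact: runs_ret.
by apply: runs_home => [|j Hj]; [lia | apply: T_start; lia].
Qed.

(** When the move out of [P m0] is blocked, the work head stands in cell [m0]; the sweep back makes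
    [m0] opposite moves and undoes precisely the partial stride. *)
Lemma runs_stride_blocked d (P : nat -> nat) m0 : m0 < k ->
  (forall m i, m < m0 -> runs x (detect d) (cells N ih T i ct (P m)) true
                                          (cells N ih T i ct (P m.+1))) ->
  (forall i, runs x (detect d) (cells N ih T i ct (P m0)) false
                               (cells N ih T i ct (P m0))) ->
  (forall m, m < m0 -> mv (flip d) (P m.+1) (size ct) = P m) ->
  runs x (stride d) (cells N ih T 0 ct (P 0)) false (cells N ih T 0 ct (P 0)).
Proof.
move=> m0k HP HP0 Hopp; apply: (@runs_bind _ _ _ _ _ _ false (cells N ih T m0 ct (P m0))).
  have H m : m <= m0 -> runs x (loop (fun _ : unit =>
    get f := detect d in
    if f then get m := get_track STRIDE in
              if m then ret (inr true) else cell_right ;; ret (inl tt)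
    else ret (inr false)) tt) (cells N ih T (m0 - m) ct (P (m0 - m))) false
      (cells N ih T m0 ct (P m0)).
    elim: m => [|m IH] mk.
      rewrite subn0.
      by apply: runs_loop_exit; apply: runs_bind; [exact: HP0 | exact: runs_ret].
    apply: runs_loop_next; last by apply: IH; lia.
    apply: runs_bind; first by apply: HP; lia.
    apply: runs_bind; first by apply: runs_get_track => //; lia.
    rewrite T_stride; last by lia.
    rewrite ifF; last by lia.
    rewrite (_ : m0 - m = (m0 - m.+1).+1); last by lia.
    by apply: runs_bind; [apply: runs_cell_right; lia | apply: runs_ret].
  by move: (H m0); rewrite subnn; apply; lia.
apply: runs_bind; last exact: runs_ret.
apply: (runs_sweep_left (T := fun _ => T) (ct := fun _ => ct) (ch := P)).
- lia.
- by move=> j Hj; apply: T_start; lia.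
- by move=> j Hj; rewrite -(Hopp j Hj); apply: runs_move_cat.
Qed.

Lemma runs_strideR p : 0 < p < size ct ->
  runs x (stride MoveR) (cells N ih T 0 ct p) (p + k < size ct)
    (cells N ih T 0 ct (if p + k < size ct then p + k else p)).
Proof.
move=> Hp; case: ltnP => H.
  rewrite -{1}(addn0 p); apply: (runs_stride_full (P := addn p)) => m i mk.
  rewrite addnS; have := @runs_detectR x ih (tracks N T) (6 * i) ct (p + m) [::].
  have -> : (p + m).+1 < size ct by lia.
  by apply; lia.
rewrite -{1 2}(addn0 p).
apply: (runs_stride_blocked (P := addn p) (m0 := (size ct).-1 - p)); first by lia.
- move=> m i mk; rewrite addnS.
  have := @runs_detectR x ih (tracks N T) (6 * i) ct (p + m) [::].
  have -> : (p + m).+1 < size ct by lia.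
  by apply; lia.
- move=> i; have := @runs_detectR x ih (tracks N T) (6 * i) ct (p + ((size ct).-1 - p)) [::].
  have -> : (p + ((size ct).-1 - p)).+1 < size ct = false by lia.
  by apply; lia.
- by move=> m _ /=; lia.
Qed.

Lemma runs_strideL p : p.+1 < size ct ->
  runs x (stride MoveL) (cells N ih T 0 ct p) (k <= p)
    (cells N ih T 0 ct (if k <= p then p - k else p)).
Proof.
move=> Hp; case: leqP => H.
  rewrite -{1}(subn0 p); apply: (runs_stride_full (P := subn p)) => m i mk.
  rewrite subnS; have := @runs_detectL x ih (tracks N T) (6 * i) ct (p - m) [::].
  have -> : 0 < p - m by lia.
  by apply; lia.
rewrite -{1 2}(subn0 p).
apply: (runs_stride_blocked (P := subn p) (m0 := p)); first by lia.
- move=> m i mk; rewrite subnS.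
  have := @runs_detectL x ih (tracks N T) (6 * i) ct (p - m) [::].
  have -> : 0 < p - m by lia.
  by apply; lia.
- move=> i; have := @runs_detectL x ih (tracks N T) (6 * i) ct (p - p) [::].
  by rewrite subnn; apply; lia.
- by move=> m mp /=; rewrite ifT; lia.
Qed.

End Stride.

Section Bump.
Variables (ih : nat) (T : nat -> nat -> bool) (ct : seq bool) (ch : nat) (b : bool).
Hypothesis T_start : forall j, j < N -> T j START = (j == 0).
Hypothesis T_end : forall j, j < N -> T j END = (j == N.-1).

Definition tick_loop : frag bool := loop (fun _ : unit =>
    get p := get_track COUNT in
    if p == b then set_track COUNT (~~ b) ;; ret (inr true)
    else get e := get_track END in
         if e then ret (inr false) else cell_right ;; ret (inl tt)) tt.

Lemma tick_loop_next j (r : bool) t : j.+1 < N -> T j COUNT = ~~ b ->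
  runs x tick_loop (cells N ih T j.+1 ct ch) r t ->
  runs x tick_loop (cells N ih T j ct ch) r t.
Proof.
move=> jN Tj; apply: runs_loop_next.
apply: runs_bind; first by apply: runs_get_track => //; lia.
rewrite Tj ifF; last by case: b.
apply: runs_bind; first by apply: runs_get_track => //; lia.
rewrite T_end; last by lia.
rewrite ifF; last by lia.
by apply: runs_bind; [exact: runs_cell_right | exact: runs_ret].
Qed.

Lemma tick_loop_skip i (r : bool) t : i < N -> (forall j, j < i -> T j COUNT = ~~ b) ->
  runs x tick_loop (cells N ih T i ct ch) r t ->
  runs x tick_loop (cells N ih T 0 ct ch) r t.
Proof.
elim: i => // i IH iN Hj H.
apply: IH => [|j ji|]; [lia | apply: Hj; lia | apply: tick_loop_next => //].
exact: Hj.
Qed.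

Lemma runs_tick_true i : i < N ->
  (forall j, j < i -> T j COUNT = ~~ b) -> T i COUNT = b ->
  runs x (tick b) (cells N ih T 0 ct ch) true
    (cells N ih (fun j r => if (r == COUNT) && (j <= i)
                            then (if j == i then ~~ b else b) else T j r) 0 ct ch).
Proof.
move=> iN Hj Hi.
apply: (@runs_bind _ _ _ _ _ _ true (cells N ih (upd T i COUNT (~~ b)) i ct ch)).
  apply: (tick_loop_skip iN Hj); apply: runs_loop_exit.
  apply: runs_bind; first exact: runs_get_track.
  rewrite Hi eqxx.
  by apply: runs_bind; [exact: runs_set_track | exact: runs_ret].
apply: runs_bind; last exact: runs_ret.
(* [T1 m] is the tape when the sweep has come down to cell [m]: the digits from [m] to [i] are
   final. *)
set T1 := fun m j r => if (r == COUNT) && (m <= j <= i)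
                       then (if j == i then ~~ b else b) else T j r.
have -> : upd T i COUNT (~~ b) = T1 i.
  apply: functional_extensionality => j; apply: functional_extensionality => r.
  rewrite /upd /T1 -eqn_leq andbC (eq_sym i j).
  by case: (j == i); case: (r == COUNT).
apply: (runs_sweep_left (T := T1) (ct := fun _ => ct) (ch := fun _ => ch)) => //.
  by move=> j Hji; rewrite /T1 /=; apply: T_start; lia.
move=> j Hji /=.
have -> : T1 j = upd (T1 j.+1) j COUNT b.
  apply: functional_extensionality => m; apply: functional_extensionality => r.
  rewrite /upd /T1; case: (altP (r =P COUNT)) => _ /=; last by rewrite andbF.
  case: (altP (m =P j)) => [->|mj] /=; first by rewrite leqnn (ltnW Hji) ifF //; lia.
  by rewrite andbC; congr (if _ then _ else _); lia.
apply: runs_set_track => //; lia.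
Qed.

Lemma runs_tick_false : 0 < N -> (forall j, j < N -> T j COUNT = ~~ b) ->
  runs x (tick b) (cells N ih T 0 ct ch) false (cells N ih T 0 ct ch).
Proof.
move=> N0 Hj.
apply: (@runs_bind _ _ _ _ _ _ false (cells N ih T N.-1 ct ch)).
  apply: (@tick_loop_skip N.-1); [lia | by move=> j ?; apply: Hj; lia |].
  apply: runs_loop_exit.
  apply: runs_bind; first by apply: runs_get_track => //; lia.
  rewrite Hj ?ifF; [| by case: b | lia].
  apply: runs_bind; first by apply: runs_get_track => //; lia.
  rewrite T_end ?eqxx; [exact: runs_ret | lia].
apply: runs_bind; last exact: runs_ret.
by apply: runs_home => [|j ?]; [lia | apply: T_start; lia].
Qed.

End Bump.
End Tracks.

(** * Binary digits and the carry of an increment *)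

Definition bitn (v i : nat) : bool := odd (v %/ 2 ^ i).

Lemma bitn0 i : bitn 0 i = false.
Proof. by rewrite /bitn div0n. Qed.

Lemma bitn_doubleS v i : bitn v.*2 i.+1 = bitn v i.
Proof. by rewrite /bitn expnS -muln2 mulnC divnMl. Qed.

Lemma bitn_doubleS1 v i : bitn v.*2.+1 i.+1 = bitn v i.
Proof. by rewrite /bitn expnS divnMA; congr (odd (_ %/ _)); lia. Qed.

Lemma bitn_low v : bitn v 0 = odd v.
Proof. by rewrite /bitn expn0 divn1. Qed.

Lemma bitn_leq v i : bitn v i -> 2 ^ i <= v.
Proof.
rewrite /bitn; case: leqP => // H.
by rewrite divn_small.
Qed.

Lemma bitn_succ v : exists i, [/\ forall j, j < i -> bitn v j, bitn v i = false,
  forall j, j < i -> bitn v.+1 j = false, bitn v.+1 i &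
  forall j, i < j -> bitn v.+1 j = bitn v j].
Proof.
elim/ltn_ind: v => v IH; have := odd_double_half v.
move: (odd v) (v./2) => [] u /= v_def; rewrite -v_def ?add0n ?add1n.
  case: (IH u) => [|i [H1 H2 H3 H4 H5]]; first by lia.
  exists i.+1; rewrite -doubleS; split=> [[|j]|||| [|j]];
    rewrite ?bitn_low ?bitn_doubleS ?bitn_doubleS1 //=.
  - by rewrite odd_double.
  - exact: H1.
  - by move=> [|j]; rewrite ?bitn_low ?bitn_doubleS ?odd_double //; apply: H3.
  - exact: H5.
exists 0; split=> //; rewrite ?bitn_low ?odd_double //=.
  by rewrite odd_double.
by move=> [|j] // _; rewrite bitn_doubleS bitn_doubleS1.
Qed.

Lemma bitn_top v k : 2 ^ k.-1 <= v < 2 ^ k -> 0 < k ->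
  bitn v k.-1 /\ forall j, k <= j -> bitn v j = false.
Proof.
move=> /andP[H1 H2] k0; split.
  rewrite /bitn (_ : v %/ _ = 1) //.
  apply/eqP; rewrite eqn_leq -ltnS ltn_divLR ?expn_gt0 // -expnS prednK // H2.
  by rewrite leq_divRL ?expn_gt0 // mul1n.
move=> j kj; apply/negbTE/negP => /bitn_leq.
by rewrite leqNgt (leq_trans H2) // leq_exp2l.
Qed.

(** * Simulation of the given machine *)

(** Cell [i] of the simulated work tape lies in block [2 * i]. As there are [2 * s + 1] blocks, two
    blocks to the right of the last simulated cell is the block marked [END]; so the end of the
    simulated tape is found without knowing [s]. *)
Definition work_move d : frag unit :=
  match d with
  | MoveS => ret tt
  | MoveL => get s := get_track START in if s then ret tt else cell_left ;; cell_left
  | MoveR => cell_right ;; cell_right ;;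
             get e := get_track END in if e then cell_left ;; cell_left else ret tt
  end.

(* The counter on track [COUNT] always holds the position of the input head:
   this is what makes it possible to return to the start of the input. *)
Definition input_move d : frag unit :=
  match d with
  | MoveS => ret tt
  | MoveL => tick true ;; move_input MoveL
  | MoveR => get i := read_input in
             if i is Some _ then tick false ;; move_input MoveR else ret tt
  end.

Definition cat_move d : frag unit :=
  match d with MoveS => ret tt | d => stride d ;; ret tt end.

Definition seek_head : frag unit :=
  loop (fun _ : unit => get h := get_track HEAD in
        if h then ret (inr tt) else cell_right ;; ret (inl tt)) tt.

(** The control remembers the last symbol printed in place of an output tape, which suffices because
    the given machine prints a single symbol. The track [HEAD] stores the place of the work head
    only while the counter and the stride need that head at the start. *)
Definition simulate_step (M : TM) (a : tm_state M * option outsym) :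
    frag (tm_state M * option outsym + option outsym) :=
  get i := read_input in get w := get_track DATA in get b := read_cat in
  match tm_delta a.1 i w b with
  | None => ret (inr a.2)
  | Some (q, bw, bc, di, dw, dc, o) =>
      set_track DATA bw ;; write_cat bc ;; work_move dw ;;
      set_track HEAD true ;; home ;; input_move di ;; cat_move dc ;;
      seek_head ;; set_track HEAD false ;;
      ret (inl (q, if o is Some b then Some b else a.2))
  end.

Definition simulate (M : TM) : frag (option outsym) :=
  loop (@simulate_step M) (tm_start M, None).

Definition clear_data : frag unit :=
  loop (fun _ : unit => set_track DATA false ;;
        get e := get_track END in
        if e then ret (inr tt) else cell_right ;; ret (inl tt)) tt.

Definition rewind_input : frag unit :=
  loop (fun _ : unit => get f := tick true in
        if f then move_input MoveL ;; ret (inl tt) else ret (inr tt)) tt.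

Definition rewind_cat : frag unit :=
  loop (fun _ : unit => get f := stride MoveL in
        if f then ret (inl tt) else ret (inr tt)) tt.

(** Restores the start configuration of the given machine except for the catalytic content, which
    that machine restores itself. *)
Definition reset : frag unit :=
  home ;; clear_data ;; home ;; rewind_input ;; rewind_cat.

Section Simulation.
Variables (x : seq bool) (s c k : nat).
Let N := s.*2.+1.
Let len := (k * c).+1.
Hypotheses (s_gt0 : 0 < s) (c_gt0 : 0 < c) (k_gt1 : 1 < k) (k_leN : k <= N).
Hypothesis x_small : size x < 2 ^ N.

Definition layout (wt : seq bool) (h : option nat) (pos i r : nat) : bool :=
  match r with
  | 0 => i == 0
  | 1 => ~~ odd i && nth false wt i./2
  | 2 => h == Some i
  | 3 => bitn pos i
  | 4 => i == k.-1
  | 5 => i == N.-1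
  | _ => false
  end.

Implicit Types (wt ct v : seq bool) (h : option nat).

Lemma runs_tick_inc ih wt h pos ct ch : pos.+1 < 2 ^ N ->
  runs x (tick false) (cells N ih (layout wt h pos) 0 ct ch) true
                      (cells N ih (layout wt h pos.+1) 0 ct ch).
Proof.
move=> Hpos; have [i [H1 H2 H3 H4 H5]] := bitn_succ pos.
(* The carry ends inside the counter: digit [i] of [pos.+1] is set, so [2 ^ i <= pos.+1 < 2 ^ N]. *)
have iN : i < N by rewrite -(@ltn_exp2l 2) //; apply: leq_ltn_trans Hpos; apply: bitn_leq.
apply: (eq_ind _ (fun T => runs x _ _ true (cells N ih T 0 ct ch))
  (@runs_tick_true x N ih (layout wt h pos) ct ch false (fun _ _ => erefl)
     (fun _ _ => erefl) i iN (fun j ji => H1 j ji) H2)).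
apply: functional_extensionality => j; apply: functional_extensionality => r.
case: (altP (r =P COUNT)) => [->|] /=; last first.
  by move: r => [|[|[|[|r]]]].
case: (ltngtP j i) => [ji|ij|->] /=; [by rewrite H3 | by rewrite H5 | by rewrite H4].
Qed.

Lemma runs_tick_dec ih wt h pos ct ch : pos.+1 < 2 ^ N ->
  runs x (tick true) (cells N ih (layout wt h pos.+1) 0 ct ch) true
                     (cells N ih (layout wt h pos) 0 ct ch).
Proof.
move=> Hpos; have [i [H1 H2 H3 H4 H5]] := bitn_succ pos.
have iN : i < N by rewrite -(@ltn_exp2l 2) //; apply: leq_ltn_trans Hpos; apply: bitn_leq.
apply: (eq_ind _ (fun T => runs x _ _ true (cells N ih T 0 ct ch))
  (@runs_tick_true x N ih (layout wt h pos.+1) ct ch true (fun _ _ => erefl)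
     (fun _ _ => erefl) i iN (fun j ji => H3 j ji) H4)).
apply: functional_extensionality => j; apply: functional_extensionality => r.
case: (altP (r =P COUNT)) => [->|] /=; last first.
  by move: r => [|[|[|[|r]]]].
by case: (ltngtP j i) => [ji|ij|->] /=; [rewrite H1 | rewrite H5 | rewrite H2].
Qed.

Lemma runs_tick_zero ih wt h ct ch :
  runs x (tick true) (cells N ih (layout wt h 0) 0 ct ch) false
                     (cells N ih (layout wt h 0) 0 ct ch).
Proof.
by apply: runs_tick_false => // j _; rewrite /layout /= bitn0.
Qed.

Lemma runs_input_move d ih wt h ct ch : ih <= size x ->
  runs x (input_move d) (cells N ih (layout wt h ih) 0 ct ch) tt
    (cells N (mv d ih (size x).+1) (layout wt h (mv d ih (size x).+1)) 0 ct ch).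
Proof.
move=> Hih; case: d => /=; first 1 last.
- exact: runs_ret.
- apply: runs_bind; first exact: runs_read_input.
  rewrite /read_in ltnS; case: ltnP => Hi; last exact: runs_ret.
  apply: runs_bind; first by apply: runs_tick_inc; lia.
  by have := runs_move_input x MoveR ih (tracks N (layout wt h ih.+1)) 0 ct ch [::];
    rewrite /mv ltnS Hi.
case: ih Hih => [|ih] Hih /=.
  apply: runs_bind; first exact: runs_tick_zero.
  exact: runs_move_input.
apply: runs_bind; first by apply: runs_tick_dec; lia.
exact: runs_move_input.
Qed.

Lemma runs_work_move d ih wt h pos i ct ch : i < s ->
  runs x (work_move d) (cells N ih (layout wt h pos) (2 * i) ct ch) tt
    (cells N ih (layout wt h pos) (2 * mv d i s) ct ch).
Proof.
move=> i_s; case: d; first 1 last.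
- exact: runs_ret.
- apply: runs_bind; first by apply: runs_cell_right; rewrite /N; lia.
  apply: runs_bind; first by apply: runs_cell_right; rewrite /N; lia.
  apply: runs_bind; first by apply: runs_get_track => //; rewrite /N; lia.
  rewrite /layout /END; case: eqP => H.
    apply: runs_bind; first exact: runs_cell_left.
    rewrite /mv ifF; [exact: runs_cell_left | rewrite /N in H; lia].
  rewrite /mv ifT; last by rewrite /N in H; lia.
  by rewrite (_ : (2 * i).+2 = 2 * i.+1); [exact: runs_ret | lia].
apply: runs_bind; first by apply: runs_get_track => //; rewrite /N; lia.
case: i i_s => [|i] i_s; first exact: runs_ret.
apply: (@runs_bind _ _ _ _ _ _ tt (cells N ih (layout wt h pos) (2 * i).+1 ct ch)).
  by rewrite (_ : 2 * i.+1 = (2 * i).+2); [exact: runs_cell_left | lia].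
exact: runs_cell_left.
Qed.

(** * The cells [o + k * i] as a tape of length [c] *)

Section Row.
Variables (ih : nat) (wt : seq bool) (h : option nat) (pos : nat) (ct : seq bool).
Variables (o i : nat).
Hypotheses (size_ct : size ct = len) (ok : 0 < o < k) (ic : i < c).

(** As [0 < o < k], the cell [o + k * i + k] lies on the tape of length [k * c + 1] exactly when
    [i.+1 < c]; a stride across the end is the blocked move of the simulated head. *)
Lemma runs_stride_right :
  runs x (stride MoveR) (cells N ih (layout wt h pos) 0 ct (o + k * i)) (i.+1 < c)
    (cells N ih (layout wt h pos) 0 ct (o + k * mv MoveR i c)).
Proof.
have kc : k * i.+1 <= k * c by rewrite leq_mul2l ic orbT.
have := @runs_strideR x N ih (layout wt h pos) k ct _ k_leN (fun _ _ => erefl)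
  (fun _ _ => erefl) (o + k * i) _.
rewrite size_ct (_ : (o + k * i + k < len) = (i.+1 < c)); last first.
  rewrite /len ltnS.
  case: (ltnP i.+1 c) => H; last by rewrite (_ : c = i.+1); lia.
  have : k * i.+2 <= k * c by rewrite leq_mul2l H orbT.
  by rewrite !mulnS; lia.
rewrite /mv; case: (ltnP i.+1 c) => H; last by apply; lia.
by rewrite (_ : o + k * i + k = o + k * i.+1); [apply; lia | lia].
Qed.

Lemma runs_stride_left :
  runs x (stride MoveL) (cells N ih (layout wt h pos) 0 ct (o + k * i)) (0 < i)
    (cells N ih (layout wt h pos) 0 ct (o + k * i.-1)).
Proof.
have kc : k * i.+1 <= k * c by rewrite leq_mul2l ic orbT.
have := @runs_strideL x N ih (layout wt h pos) k ct _ k_leN (fun _ _ => erefl)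
    (fun _ _ => erefl) (o + k * i) _.
case: i ic kc => [|j] jc kc; rewrite size_ct.
  by rewrite (_ : (k <= _) = false) /len; [apply; lia | lia].
rewrite (_ : (k <= _) = true); last by lia.
by rewrite (_ : o + k * j.+1 - k = o + k * j) /len; [apply; lia | lia].
Qed.

Lemma runs_cat_move d :
  runs x (cat_move d) (cells N ih (layout wt h pos) 0 ct (o + k * i)) tt
    (cells N ih (layout wt h pos) 0 ct (o + k * mv d i c)).
Proof.
case: d; [| exact: runs_ret |];
  by apply: runs_bind; [exact: runs_stride_left || exact: runs_stride_right | exact: runs_ret].
Qed.

End Row.

(** Keeping the surrounding tape [ct] as a parameter makes it evident that a simulation changes only
    block [o]. *)
Definition embed (o : nat) (ct v : seq bool) : seq bool :=
  mkseq (fun p => if p %% k == o then nth false v (p %/ k) else nth false ct p) len.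

Lemma size_embed o ct v : size (embed o ct v) = len.
Proof. exact: size_mkseq. Qed.

Lemma position_lt o i : o < k -> i < c -> o + k * i < len.
Proof.
move=> ok ic; have : k * i.+1 <= k * c by rewrite leq_mul2l ic orbT.
by rewrite mulnS /len; lia.
Qed.

Lemma nth_embed o ct v i : o < k -> i < c -> nth false (embed o ct v) (o + k * i) = nth false v i.
Proof.
move=> ok ic; rewrite nth_mkseq ?position_lt // addnC mulnC modnMDl modn_small //.
by rewrite eqxx divnMDl ?divn_small ?addn0 //; lia.
Qed.

Lemma wr_embed o ct v i b : 0 < o < k -> i < c -> size v = c ->
  wr (embed o ct v) (o + k * i) b = embed o ct (wr v i b).
Proof.
move=> ok ic size_v; apply: (@eq_from_nth _ false); first by rewrite size_wr !size_embed.
move=> j; rewrite size_wr size_embed => jlt; rewrite nth_wr size_embed position_lt; [|lia|done].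
rewrite andbT !nth_mkseq // nth_wr size_v ic andbT.
case: (altP (j =P o + k * i)) => [->|jn].
  rewrite addnC mulnC modnMDl modn_small ?eqxx; last by lia.
  by rewrite divnMDl ?divn_small ?addn0 ?eqxx //; lia.
case: (altP (j %% k =P o)) => // Ej; rewrite ifF //.
apply/negbTE; apply: contraNneq jn => Ei.
by rewrite {1}(divn_eq j k) Ej Ei addnC mulnC.
Qed.

Section Machine.
Variables (M : TM) (o : nat) (ct0 : seq bool).
Hypothesis ok : 0 < o < k.

Definition well_formed (cf : config M) :=
  [/\ ih cf <= size x, size (wt cf) = s, wh cf < s, size (ct cf) = c & chd cf < c].

(** The invariant between simulated steps: no head mark is stored and the counter equals the input
    head position. *)
Definition simulated (cf : config M) : tapes :=
  cells N (ih cf) (layout (wt cf) None (ih cf)) (2 * wh cf)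
        (embed o ct0 (ct cf)) (o + k * chd cf).

Definition last_out (cf : config M) : option outsym := last None (map Some (out cf)).

Lemma mv_lt d i n : i < n -> mv d i n < n.
Proof. by case: d => //= H; [lia | case: ifP]. Qed.

Lemma step_well_formed cf cf' : well_formed cf -> step x cf = Some cf' -> well_formed cf'.
Proof.
case=> H1 H2 H3 H4 H5; rewrite /step.
case: tm_delta => // -[[[[[[q bw] bc] di] dw] dc] b] [<-]; split => /=.
- by rewrite -ltnS; apply: mv_lt.
- by rewrite size_wr.
- by rewrite H2; apply: mv_lt.
- by rewrite size_wr.
- by rewrite H4; apply: mv_lt.
Qed.

Lemma read_simulated A (F : option bool -> bool -> bool -> frag A) cf a t : well_formed cf ->
  let i := read_in x (ih cf) in
  let w := nth false (wt cf) (wh cf) in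
  let b := nth false (ct cf) (chd cf) in
  runs x (F i w b) (simulated cf) a t ->
  runs x (get i := read_input in get w := get_track DATA in get b := read_cat in F i w b)
    (simulated cf) a t.
Proof.
case=> H1 H2 H3 H4 H5 i w b HF.
apply: runs_bind; first exact: runs_read_input.
apply: runs_bind; first by apply: runs_get_track => //; rewrite /N; lia.
apply: runs_bind; first exact: runs_read_cat.
rewrite nth_embed; [|lia|done].
rewrite [layout _ _ _ _ DATA](_ : _ = w) //.
by rewrite /layout /= mul2n odd_double doubleK.
Qed.

Lemma runs_seek_head pos wt j ih ct ch : j < N ->
  runs x seek_head (cells N ih (layout wt (Some j) pos) 0 ct ch) tt
                   (cells N ih (layout wt (Some j) pos) j ct ch).
Proof.
move=> hN; suff H m : m <= j -> runs x seek_head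
    (cells N ih (layout wt (Some j) pos) (j - m) ct ch) tt
    (cells N ih (layout wt (Some j) pos) j ct ch).
  by move: (H j); rewrite subnn; apply.
elim: m => [|m IH] mh.
  rewrite subn0; apply: runs_loop_exit.
  apply: runs_bind; first exact: runs_get_track.
  by rewrite /layout /= eqxx; apply: runs_ret.
apply: runs_loop_next; last by apply: IH; lia.
apply: runs_bind; first by apply: runs_get_track => //; lia.
rewrite /layout /HEAD ifF; last by apply/eqP => -[]; lia.
rewrite (_ : j - m = (j - m.+1).+1); last by lia.
by apply: runs_bind; [apply: runs_cell_right; lia | exact: runs_ret].
Qed.

Lemma upd_data wt h pos i b : i < size wt ->
  upd (layout wt h pos) (2 * i) DATA b = layout (wr wt i b) h pos.
Proof.
move=> Hi; apply: functional_extensionality => j; apply: functional_extensionality => r.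
rewrite /upd; case: (altP (r =P DATA)) => [->|] /=; last first.
  by rewrite andbF; move: r => [|[|[|[|r]]]].
rewrite andbT nth_wr Hi andbT; case: (altP (j =P 2 * i)) => [->|ji].
  by rewrite mul2n odd_double doubleK eqxx.
by case: (boolP (odd j)) => //= oj; rewrite ifF //; lia.
Qed.

Lemma upd_head wt h pos i (b : bool) : (if b then h = None else h = Some i) ->
  upd (layout wt h pos) i HEAD b = layout wt (if b then Some i else None) pos.
Proof.
move=> Hh; apply: functional_extensionality => j; apply: functional_extensionality => r.
rewrite /upd; case: (altP (r =P HEAD)) => [->|] /=; last first.
  by rewrite andbF; move: r => [|[|[|[|r]]]].
rewrite andbT; case: b Hh => -> /=; case: (altP (j =P i)) => [->|ji]; rewrite ?eqxx //.
  by apply/esym/eqP => -[] /esym/eqP; apply/negP.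
by apply/eqP => -[] /esym/eqP; apply/negP.
Qed.

Lemma runs_simulate_step cf cf' : well_formed cf -> step x cf = Some cf' ->
  runs x (simulate_step (cq cf, last_out cf)) (simulated cf)
    (inl (cq cf', last_out cf')) (simulated cf').
Proof.
move=> wf; have [H1 H2 H3 H4 H5] := wf; rewrite /step => Hstep.
apply: (@read_simulated _ (fun i w b => match tm_delta _ i w b with
  | Some (q, bw, bc, di, dw, dc, o) => _ | None => _ end)) => //.
case: tm_delta Hstep => // -[[[[[[q bw] bc] di] dw] dc] b] [<-].
apply: runs_bind; first by apply: runs_set_track => //; rewrite /N; lia.
rewrite upd_data ?H2 //.
apply: runs_bind; first exact: runs_write_cat.
rewrite wr_embed //.
apply: runs_bind; first exact: runs_work_move.
have Hw := mv_lt dw H3.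
apply: runs_bind; first by apply: runs_set_track => //; rewrite /N; lia.
rewrite upd_head //.
apply: runs_bind; first by apply: runs_home; rewrite /N // ; lia.
apply: runs_bind; first exact: runs_input_move.
apply: runs_bind; first by apply: runs_cat_move => //; exact: size_embed.
apply: runs_bind; first by apply: runs_seek_head; rewrite /N; lia.
apply: runs_bind; first by apply: runs_set_track => //; rewrite /N; lia.
rewrite upd_head //.
rewrite /simulated /= ?H2 ?H4 /last_out /=.
case: b => [b|]; last exact: runs_ret.
by rewrite map_rcons last_rcons; exact: runs_ret.
Qed.

Lemma runs_simulate_halt cf : well_formed cf -> step x cf = None ->
  runs x (simulate_step (cq cf, last_out cf)) (simulated cf)
    (inr (last_out cf)) (simulated cf).
Proof.
move=> wf; rewrite /step => Hstep.
apply: (@read_simulated _ (fun i w b => match tm_delta _ i w b with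
  | Some (q, bw, bc, di, dw, dc, o) => _ | None => _ end)) => //.
by case: tm_delta Hstep => [[[[[[[q bw] bc] di] dw] dc] b]|] // _; exact: runs_ret.
Qed.

Lemma runs_simulate_run m cf cf' : well_formed cf -> run x m cf = Some cf' ->
  runs x (loop (@simulate_step M) (cq cf, last_out cf)) (simulated cf)
    (last_out cf') (simulated cf') /\ well_formed cf'.
Proof.
elim: m cf => //= m IH cf wf; case E: (step x cf) => [cf1|].
  have wf1 := step_well_formed wf E; move=> /(IH _ wf1) [H wf']; split=> //.
  by apply: runs_loop_next H; apply: runs_simulate_step.
by case=> <-; split=> //; apply: runs_loop_exit; apply: runs_simulate_halt.
Qed.

Lemma runs_simulate tau cf : size tau = c -> halts_in M x s tau cf ->
  runs x (simulate M)
    (cells N 0 (layout (nseq s false) None 0) 0 (embed o ct0 tau) o)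
    (last_out cf) (simulated cf) /\ well_formed cf.
Proof.
move=> size_tau [m Hrun].
have wf : well_formed (init M x s tau) by split=> //=; rewrite size_nseq.
have := runs_simulate_run wf Hrun.
by rewrite /simulated /= !muln0 addn0.
Qed.

Lemma runs_rewind_cat ih wt pos ct i : size ct = len -> i < c ->
  runs x rewind_cat (cells N ih (layout wt None pos) 0 ct (o + k * i)) tt
    (cells N ih (layout wt None pos) 0 ct o).
Proof.
move=> size_ct; elim: i => [|i IH] ic.
  apply: runs_loop_exit; apply: runs_bind; first exact: runs_stride_left.
  by rewrite muln0 addn0; exact: runs_ret.
apply: runs_loop_next; last by apply: IH; lia.
by apply: runs_bind; [exact: runs_stride_left | exact: runs_ret].
Qed.

Lemma runs_rewind_input ih wt ct ch : ih <= size x ->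
  runs x rewind_input (cells N ih (layout wt None ih) 0 ct ch) tt
    (cells N 0 (layout wt None 0) 0 ct ch).
Proof.
elim: ih => [|i IH] Hi.
  apply: runs_loop_exit; apply: runs_bind; [exact: runs_tick_zero | exact: runs_ret].
apply: runs_loop_next; last by apply: IH; lia.
apply: runs_bind; first by apply: runs_tick_dec; lia.
by apply: runs_bind; [exact: runs_move_input | exact: runs_ret].
Qed.

Lemma runs_clear_data ih wt pos ct ch : size wt = s ->
  runs x clear_data (cells N ih (layout wt None pos) 0 ct ch) tt
    (cells N ih (layout (nseq s false) None pos) N.-1 ct ch).
Proof.
move=> size_wt.
pose T i j r := if (r == DATA) && (j < i) then false else layout wt None pos j r.
have TS i : upd (T i) i DATA false = T i.+1.
  apply: functional_extensionality => j; apply: functional_extensionality => r.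
  rewrite /upd /T; case: (altP (r =P DATA)) => _ /=; last by rewrite andbF.
  by rewrite ltnS andbT; case: ltngtP.
have -> : layout (nseq s false) None pos = T N.
  apply: functional_extensionality => j; apply: functional_extensionality => r.
  rewrite /T; case: (altP (r =P DATA)) => [->|] /=; last by move: r => [|[|]].
  (* [layout] is a function on all numbers, so the blocks from [N] on must agree too; there [wt] is
     past its end and reads as [false]. *)
  rewrite nth_nseq if_same andbF; case: (ltnP j N) => // jN.
  by rewrite nth_default ?andbF // size_wt; move: jN; rewrite /N; lia.
have -> : layout wt None pos = T 0.
  by apply: functional_extensionality => j; apply: functional_extensionality => r;
    rewrite /T ltn0 andbF.
suff H m : m < N -> runs x clear_data (cells N ih (T (N.-1 - m)) (N.-1 - m) ct ch) tt
    (cells N ih (T N) N.-1 ct ch).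
  by move: (H N.-1); rewrite subnn; apply; rewrite /N.
elim: m => [|m IH] mN.
  rewrite subn0; apply: runs_loop_exit.
  apply: runs_bind; first by apply: runs_set_track.
  rewrite TS prednK //.
  apply: runs_bind; first by apply: runs_get_track.
  by rewrite /T /layout /END /= eqxx; exact: runs_ret.
apply: runs_loop_next; last by apply: IH; lia.
apply: runs_bind; first by apply: runs_set_track => //; lia.
rewrite TS (_ : N.-1 - m = (N.-1 - m.+1).+1); last by lia.
apply: runs_bind; first by apply: runs_get_track => //; lia.
rewrite [X in if X then _ else _](_ : _ = false); last by rewrite /T /layout /END /=; lia.
by apply: runs_bind; [apply: runs_cell_right; lia | exact: runs_ret].
Qed.

Lemma runs_reset cf : well_formed cf ->
  runs x reset (simulated cf) tt
    (cells N 0 (layout (nseq s false) None 0) 0 (embed o ct0 (ct cf)) o).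
Proof.
case=> H1 H2 H3 H4 H5.
apply: runs_bind; first by apply: runs_home; rewrite /N //; lia.
apply: runs_bind; first exact: runs_clear_data.
apply: runs_bind; first by apply: runs_home.
apply: runs_bind; first exact: runs_rewind_input.
by apply: runs_rewind_cat => //; exact: size_embed.
Qed.

End Machine.
End Simulation.

(** * Initialization *)

(** The order of the tracks reveals the end of the work tape: after [cell_right] the head is on bit
    [START] of the next block, which is 0, or, if stopped by the end, on the last bit [END] of the
    same block, which was just set to 1. *)
Definition set_marks : frag unit :=
  set_track START true ;;
  loop (fun _ : unit =>
    set_track END true ;; cell_right ;;
    get b := read_work in
    if b then steps_work MoveL 5 ;; ret (inr tt)
    else cell_left ;; set_track END false ;; cell_right ;; ret (inl tt)) tt ;;
  home.

(** The first move leaves cell [0], since [detect MoveR] needs a neighbour on the left; so the cells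
    [1] to [k * c] are counted. *)
Definition count_cells : frag unit :=
  move_cat MoveR ;;
  loop (fun _ : unit => tick false ;; get f := detect MoveR in
        if f then ret (inl tt) else ret (inr tt)) tt.

Definition seek_end : frag unit :=
  loop (fun _ : unit => get e := get_track END in
        if e then ret (inr tt) else cell_right ;; ret (inl tt)) tt.

Definition seek_top_digit : frag unit :=
  loop (fun _ : unit => get b := get_track COUNT in
        if b then ret (inr tt) else cell_left ;; ret (inl tt)) tt.

(** The highest digit of [k * c] sits in block [k - 1], just where the stride mark belongs. The
    counter is then cleared, as from now on it holds the position [0] of the input head. *)
Definition mark_stride : frag unit :=
  seek_end ;; seek_top_digit ;; set_track STRIDE true ;;
  set_track COUNT false ;; sweep_left (set_track COUNT false).

Definition initialize : frag unit :=
  set_marks ;; count_cells ;; mark_stride ;; move_cat MoveL ;; rewind_cat.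

Section Initialization.
Variables (x : seq bool) (s c k : nat).
Let N := s.*2.+1.
Let len := (k * c).+1.
Hypotheses (s_gt0 : 0 < s) (c_gt0 : 0 < c) (k_gt1 : 1 < k) (k_leN : k <= N).
Hypothesis k_bits : 2 ^ k.-1 <= k * c < 2 ^ k.
Hypothesis x_small : size x < 2 ^ N.

(* Before the stride is known there is no mark on track [STRIDE]: it is as if
   it were beyond the end of the tape. *)
Let layout0 := layout s N.+1 (nseq s false) None.
Let layout1 := layout s k (nseq s false) None.

Implicit Types (T : nat -> nat -> bool) (ct v : seq bool).

Lemma eq_tracks T T' : (forall i r, i < N -> r < 6 -> T i r = T' i r) ->
  tracks N T = tracks N T'.
Proof.
move=> E; apply: (@eq_from_nth _ false); first by rewrite !size_tracks.
by move=> j; rewrite size_tracks => jN; rewrite !nth_mkseq //; apply: E; lia.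
Qed.

Lemma steps_workR_blocked n ih wt wh ct ch o : wh < size wt ->
  runs x (steps_work MoveR n) (Tapes ih wt wh ct ch o) tt
    (Tapes ih wt (minn (wh + n) (size wt).-1) ct ch o).
Proof.
elim: n wh => [|n IH] wh H.
  by rewrite addn0 (minn_idPl _); [exact: runs_ret | lia].
apply: runs_bind; first exact: runs_move_work.
rewrite /mv; case: ltnP => H1.
  by rewrite -addSnnS; apply: IH.
rewrite (_ : minn _ _ = minn (wh + n) (size wt).-1); last by lia.
exact: IH.
Qed.

Lemma runs_set_marks ih ct ch :
  runs x set_marks (Tapes ih (nseq (6 * N) false) 0 ct ch [::]) tt
    (cells N ih (layout0 0) 0 ct ch).
Proof.
pose T0 i r := (r == START) && (i == 0).
pose T1 i r := T0 i r || (r == END) && (i == N.-1).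
have -> : nseq (6 * N) false = tracks N (fun _ _ => false).
  apply: (@eq_from_nth _ false); first by rewrite size_nseq size_tracks.
  by move=> j; rewrite size_nseq => jN; rewrite nth_nseq nth_mkseq // if_same.
apply: (@runs_bind _ _ _ _ _ _ tt (cells N ih T0 0 ct ch)).
  rewrite (_ : T0 = upd (fun _ _ => false) 0 START true).
    exact: (@runs_set_track x N ih (fun _ _ => false) 0 START true ct ch).
  apply: functional_extensionality => j; apply: functional_extensionality => r.
  by rewrite /upd /T0 andbC; case: ifP.
have set_end i : i < N -> upd (upd T0 i END true) i END false = T0.
  move=> _; apply: functional_extensionality => j; apply: functional_extensionality => r.
  by rewrite /upd /T0; case: eqP => //=; case: eqP => // ->.
apply: (@runs_bind _ _ _ _ _ _ tt (cells N ih T1 N.-1 ct ch)); last first.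
  rewrite /cells (@eq_tracks (layout0 0) T1).
    apply: (@runs_home x N ih T1 ct ch N.-1) => [|j jN]; first by rewrite /N.
    by rewrite /T1 /T0 orbF.
  move=> i r iN; rewrite /layout0 /T1 /T0.
  move: r => [|[|[|[|[|[|r]]]]]] // _; rewrite /layout ?orbF ?bitn0 ?nth_nseq ?if_same ?andbF //.
  by rewrite ltn_eqF.
suff H m : m < N -> runs x (loop (fun _ : unit =>
    set_track END true ;; cell_right ;;
    get b := read_work in
    if b then steps_work MoveL 5 ;; ret (inr tt)
    else cell_left ;; set_track END false ;; cell_right ;; ret (inl tt)) tt)
    (cells N ih T0 (N.-1 - m) ct ch) tt (cells N ih T1 N.-1 ct ch).
  by move: (H N.-1); rewrite subnn; apply; rewrite /N.
elim: m => [|m IH] mN.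
  rewrite subn0; apply: runs_loop_exit.
  apply: runs_bind; first exact: runs_set_track.
  have -> : upd T0 N.-1 END true = T1.
    apply: functional_extensionality => j; apply: functional_extensionality => r.
    rewrite /upd /T1 /T0; case: (altP (r =P END)) => [->|] /=; last by rewrite andbF orbF.
    by rewrite andbT; case: eqP.
  (* In the last block [cell_right] gets only five bits far, to the bit [END]. *)
  apply: runs_bind; first by apply: steps_workR_blocked; rewrite size_tracks; lia.
  rewrite size_tracks (_ : minn _ _ = 6 * N.-1 + 5); last by lia.
  apply: runs_bind; first exact: runs_read_work.
  rewrite nth_tracks // /T1 eqxx orbT.
  apply: runs_bind; first exact: steps_workL.
  by rewrite addnK; exact: runs_ret.
apply: runs_loop_next; last by apply: IH; lia.
apply: runs_bind; first by apply: runs_set_track => //; lia.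
apply: runs_bind; first by apply: runs_cell_right; lia.
apply: runs_bind; first exact: runs_read_work.
rewrite -(addn0 (6 * _)) nth_tracks //; last by lia.
rewrite addn0 ifF; last by rewrite /upd andbF.
apply: runs_bind; first exact: runs_cell_left.
apply: runs_bind; first by apply: runs_set_track => //; lia.
rewrite set_end; last by lia.
rewrite (_ : N.-1 - m = (N.-1 - m.+1).+1); last by lia.
by apply: runs_bind; [apply: runs_cell_right; lia | exact: runs_ret].
Qed.

Lemma kc_gt1 : 1 < k * c.
Proof. by apply: leq_trans k_gt1 _; rewrite leq_pmulr. Qed.

Lemma runs_count_cells ih ct : size ct = len ->
  runs x count_cells (cells N ih (layout0 0) 0 ct 0) tt
    (cells N ih (layout0 (k * c)) 0 ct (k * c)).
Proof.
move=> size_ct; have kc1 := kc_gt1.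
apply: runs_bind; first exact: runs_move_cat.
rewrite /mv size_ct ifT; last by rewrite /len; lia.
suff H m : m < k * c -> runs x (loop (fun _ : unit =>
    tick false ;; get f := detect MoveR in if f then ret (inl tt) else ret (inr tt)) tt)
    (cells N ih (layout0 ((k * c).-1 - m)) 0 ct (k * c - m)) tt
    (cells N ih (layout0 (k * c)) 0 ct (k * c)).
  by move: (H (k * c).-1); rewrite subnn (_ : k * c - (k * c).-1 = 1); [apply|]; lia.
have tick_ok p : p < k * c -> runs x (tick false) (cells N ih (layout0 p) 0 ct p.+1) true
    (cells N ih (layout0 p.+1) 0 ct p.+1).
  move=> Hp; apply: runs_tick_inc; case/andP: k_bits => _ H.
  by apply: (leq_ltn_trans Hp); apply: leq_trans H _; rewrite leq_exp2l.
elim: m => [|m IH] mkc.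
  rewrite !subn0; apply: runs_loop_exit.
  apply: runs_bind; first by rewrite -{2}(prednK (ltnW kc1)); apply: tick_ok; lia.
  rewrite prednK; last by lia.
  apply: (@runs_bind _ _ _ _ _ _ false); last exact: runs_ret.
  have := @runs_detectR x ih (tracks N (layout0 (k * c))) 0 ct (k * c) [::].
  by rewrite size_ct /len ltnn; apply; lia.
apply: runs_loop_next; last by apply: IH; lia.
apply: runs_bind.
  by rewrite (_ : k * c - m.+1 = ((k * c).-1 - m.+1).+1); [apply: tick_ok; lia | lia].
rewrite (_ : ((k * c).-1 - m.+1).+1 = (k * c).-1 - m); last by lia.
apply: (@runs_bind _ _ _ _ _ _ true); last exact: runs_ret.
have := @runs_detectR x ih (tracks N (layout0 ((k * c).-1 - m))) 0 ct ((k * c).-1 - m) [::].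
rewrite size_ct /len (_ : _.+1 < _ = true); last by lia.
by rewrite (_ : ((k * c).-1 - m).+1 = k * c - m); [apply; lia | lia].
Qed.

Lemma runs_mark_stride ih ct ch :
  runs x mark_stride (cells N ih (layout0 (k * c)) 0 ct ch) tt
    (cells N ih (layout1 0) 0 ct ch).
Proof.
have [top above] := bitn_top k_bits (ltnW k_gt1).
apply: (@runs_bind _ _ _ _ _ _ tt (cells N ih (layout0 (k * c)) N.-1 ct ch)).
  suff H m : m < N -> runs x seek_end (cells N ih (layout0 (k * c)) (N.-1 - m) ct ch) tt
      (cells N ih (layout0 (k * c)) N.-1 ct ch).
    by move: (H N.-1); rewrite subnn; apply; rewrite /N.
  elim: m => [|m IH] mN.
    rewrite subn0; apply: runs_loop_exit.
    apply: runs_bind; first exact: runs_get_track.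
    by rewrite /layout0 /layout /END eqxx; exact: runs_ret.
  apply: runs_loop_next; last by apply: IH; lia.
  apply: runs_bind; first by apply: runs_get_track => //; lia.
  rewrite /layout0 /layout /END ifF; last by rewrite /N; lia.
  rewrite (_ : N.-1 - m = (N.-1 - m.+1).+1); last by lia.
  by apply: runs_bind; [apply: runs_cell_right; lia | exact: runs_ret].
apply: (@runs_bind _ _ _ _ _ _ tt (cells N ih (layout0 (k * c)) k.-1 ct ch)).
  suff H m : k.-1 + m < N -> runs x seek_top_digit
      (cells N ih (layout0 (k * c)) (k.-1 + m) ct ch) tt
      (cells N ih (layout0 (k * c)) k.-1 ct ch).
    by move: (H (N - k)); rewrite (_ : k.-1 + (N - k) = N.-1); [apply|]; lia.
  elim: m => [|m IH] mN.
    rewrite addn0; apply: runs_loop_exit.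
    apply: runs_bind; first by apply: runs_get_track => //; lia.
    by rewrite /layout0 /layout /COUNT top; exact: runs_ret.
  apply: runs_loop_next; last by apply: IH; lia.
  apply: runs_bind; first by apply: runs_get_track => //; lia.
  rewrite /layout0 /layout /COUNT above; last by lia.
  by rewrite addnS; apply: runs_bind; [exact: runs_cell_left | exact: runs_ret].
apply: runs_bind; first by apply: runs_set_track => //; lia.
apply: runs_bind; first by apply: runs_set_track => //; lia.
pose T j i r := if (r == COUNT) && (j <= i) then false else layout1 (k * c) i r.
rewrite /cells (@eq_tracks _ (T k.-1)); last first.
  move=> i r iN r6; rewrite /upd /T.
  case: (altP (r =P COUNT)) => [->|rC] /=.
    rewrite andbT andbF; case: (ltngtP k.-1 i) => // ki.
    by rewrite /layout0 /layout /COUNT above //; lia.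
  rewrite andbF; case: (altP (r =P STRIDE)) => [->|rS] /=.
    by rewrite andbT /layout0 /layout1 /layout /STRIDE; case: eqP => // _; lia.
  rewrite andbF; move: r rC rS {r6} => [|[|[|[|[|[|r]]]]]] //.
have -> : layout1 0 = T 0.
  apply: functional_extensionality => i; apply: functional_extensionality => r.
  rewrite /T; case: (altP (r =P COUNT)) => [->|] /=; first by rewrite /layout1 /layout bitn0.
  by move: r => [|[|[|[|[|[|r]]]]]].
apply: (runs_sweep_left (T := T) (ct := fun _ => ct) (ch := fun _ => ch)) => //.
  by lia.
move=> j jk.
have -> : T j = upd (T j.+1) j COUNT false.
  apply: functional_extensionality => i; apply: functional_extensionality => r.
  rewrite /T /upd; case: (altP (r =P COUNT)) => _ /=; last by rewrite andbF.
  by rewrite andbT; case: ltngtP.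
by apply: runs_set_track => //; lia.
Qed.

Lemma runs_initialize ct : size ct = len ->
  runs x initialize (Tapes 0 (nseq (6 * N) false) 0 ct 0 [::]) tt
    (cells N 0 (layout1 0) 0 ct k.-1).
Proof.
move=> size_ct; have kc1 := kc_gt1.
apply: runs_bind; first exact: runs_set_marks.
apply: runs_bind; first exact: runs_count_cells.
apply: runs_bind; first exact: runs_mark_stride.
apply: runs_bind; first exact: runs_move_cat.
(* The head is on the last cell of block [k - 1]; rewinding leads to its first cell, where the
   search starts. *)
rewrite /mv (_ : (k * c).-1 = k.-1 + k * c.-1).
  by apply: (@runs_rewind_cat x s c k) => //; rewrite ?ltn_predL //; lia.
by case: c c_gt0 => // c' _; rewrite mulnS /=; lia.
Qed.

End Initialization.

(** * The search over the blocks *)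

(** Binary successor modulo [2 ^ size v], lowest digit first: the order in which strides to the
    right meet the cells of a block. *)
Fixpoint inc (v : seq bool) : seq bool :=
  match v with
  | [::] => [::]
  | true :: v => false :: inc v
  | false :: v => true :: v
  end.

Lemma size_inc v : size (inc v) = size v.
Proof. by elim: v => //= -[] v //= ->. Qed.

Lemma iter_inc_cons t b v : iter t.*2 inc (b :: v) = b :: iter t inc v.
Proof. by elim: t => //= t ->; case: b. Qed.

(** Two increments keep the lowest digit and add one to the rest, so the count for the rest is
    doubled, plus one if the lowest digit must flip. A flip from 1 to 0 passes a carry, hence the
    count from [inc v]. *)
Lemma inc_reaches u v : size u = size v -> exists t, iter t inc v = u.
Proof.
elim: u v => [|a u IH] [|b v] //=; first by exists 0.
case=> size_u; have [t Ht] := IH v size_u.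
have [t' Ht'] : exists t, iter t inc (inc v) = u by apply: IH; rewrite size_inc.
case: a b => [] [].
- by exists t.*2; rewrite iter_inc_cons Ht.
- by exists t.*2.+1; rewrite iterS iter_inc_cons Ht.
- by exists t'.*2.+1; rewrite iterSr /= iter_inc_cons Ht'.
- by exists t.*2; rewrite iter_inc_cons Ht.
Qed.

Definition increment : frag unit :=
  loop (fun _ : unit => get b := read_cat in write_cat (~~ b) ;;
        if b then get f := stride MoveR in if f then ret (inl tt) else ret (inr tt)
        else ret (inr tt)) tt.

(* The offsets are tried in decreasing order; [brute] is set once offset 1 has
   been reached. *)
Definition next_block (brute : bool) : frag bool :=
  if brute then increment ;; rewind_cat ;; ret true
  else move_cat MoveL ;; get f := detect MoveL in move_cat MoveR ;; ret (~~ f).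

Definition search (M : TM) : bool -> frag unit :=
  loop (fun brute : bool =>
    get a := simulate M in
    if a is Some (Some b) then emit (Some b) ;; ret (inr tt)
    else reset ;; get brute' := next_block brute in ret (inl brute')).

(* Inputs of length at most 1 are treated separately because [s] and [c] may
   vanish on them. *)
Definition machine (L : seq bool -> bool) (M : TM) : frag unit :=
  get i := read_input in
  if i isn't Some b then emit (Some (L [::]))
  else move_input MoveR ;; get i := read_input in
       if i isn't Some _ then emit (Some (L [:: b]))
       else move_input MoveL ;; initialize ;; search M false.

Section Search.
Variables (M : TM) (x : seq bool) (s c k : nat).
Let N := s.*2.+1.
Let len := (k * c).+1.
Hypotheses (s_gt0 : 0 < s) (c_gt0 : 0 < c) (k_gt1 : 1 < k) (k_leN : k <= N).
Hypothesis k_bits : 2 ^ k.-1 <= k * c < 2 ^ k.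
Hypothesis x_small : size x < 2 ^ N.

Implicit Types (ct u v : seq bool) (o i : nat).

Let state ct ch := cells N 0 (layout s k (nseq s false) None 0) 0 ct ch.

Definition block o ct := mkseq (fun i => nth false ct (o + k * i)) c.

Lemma size_block o ct : size (block o ct) = c.
Proof. exact: size_mkseq. Qed.

Lemma embed_block o ct : size ct = len -> 0 < o < k -> embed c k o ct (block o ct) = ct.
Proof.
move=> size_ct ok; apply: (@eq_from_nth _ false); first by rewrite size_embed.
move=> j; rewrite size_embed => jlt; rewrite nth_mkseq //.
case: (altP (j %% k =P o)) => // Ej.
have jE : j = o + k * (j %/ k) by rewrite {1}(divn_eq j k) Ej addnC mulnC.
rewrite nth_mkseq -?jE // -(@ltn_pmul2l k); last by lia.
by move: jlt; rewrite {1}jE /len; lia.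
Qed.

(** [u] is the part already passed by the carry. The head may stop anywhere in the block, hence the
    existential position; it is rewound afterwards. *)
Lemma runs_increment ct o u v : 0 < o < k -> size (u ++ v) = c -> v != [::] ->
  exists2 i, i < c &
    runs x increment (state (embed c k o ct (u ++ v)) (o + k * size u)) tt
                     (state (embed c k o ct (u ++ inc v)) (o + k * i)).
Proof.
move=> ok; elim: v u => [//|b v IH] u size_uv _.
have uc : size u < c by move: size_uv; rewrite size_cat /=; lia.
have bE : nth false (u ++ b :: v) (size u) = b by rewrite nth_cat ltnn subnn.
have wrE : wr (u ++ b :: v) (size u) (~~ b) = u ++ ~~ b :: v.
  apply: (@eq_from_nth _ false); first by rewrite size_wr !size_cat.
  move=> j _; rewrite nth_wr size_uv uc andbT !nth_cat.
  case: (altP (j =P size u)) => [->|ju]; first by rewrite ltnn subnn.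
  by case: ltnP => // uj; rewrite -(@subnSK (size u) j) //; lia.
have start t r : runs x (if b then get f := stride MoveR in
      if f then ret (inl tt) else ret (inr tt) else ret (inr tt))
      (state (embed c k o ct (u ++ ~~ b :: v)) (o + k * size u)) r t ->
    runs x (get b := read_cat in write_cat (~~ b) ;;
        if b then get f := stride MoveR in if f then ret (inl tt) else ret (inr tt)
        else ret (inr tt))
      (state (embed c k o ct (u ++ b :: v)) (o + k * size u)) r t.
  move=> H; apply: runs_bind; first exact: runs_read_cat.
  rewrite (@nth_embed x s c k) //; last by lia.
  rewrite bE; apply: runs_bind; first exact: runs_write_cat.
  by rewrite (@wr_embed x s c k) // wrE.
have strideE : runs x (stride MoveR)
    (state (embed c k o ct (u ++ ~~ b :: v)) (o + k * size u)) ((size u).+1 < c)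
    (state (embed c k o ct (u ++ ~~ b :: v)) (o + k * mv MoveR (size u) c)).
  by apply: (@runs_stride_right x s c k) => //; exact: size_embed.
case: b => /= in size_uv bE wrE start strideE *; last first.
  by exists (size u) => //; apply: runs_loop_exit; apply: start; exact: runs_ret.
case: v IH size_uv {bE wrE} start strideE => [|b' v] IH size_uv start.
  move: size_uv; rewrite size_cat /= addn1 => size_u; rewrite size_u ltnn.
  move=> strideE; exists (size u) => //; apply: runs_loop_exit; apply: start.
  by apply: runs_bind; [exact: strideE | exact: runs_ret].
have -> : (size u).+1 < c by move: size_uv; rewrite size_cat /=; lia.
move=> strideE; have [||i ic Hi] := IH (rcons u false) => //.
  by rewrite cat_rcons -size_uv !size_cat.
exists i => //; apply: runs_loop_next.
  by apply: start; apply: runs_bind; [exact: strideE | exact: runs_ret].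
by move: Hi; rewrite !cat_rcons size_rcons.
Qed.

Lemma runs_next_brute ct o v : 0 < o < k -> size v = c ->
  runs x (next_block true) (state (embed c k o ct v) o) true
    (state (embed c k o ct (inc v)) o).
Proof.
move=> ok size_v; have [||i ic] := @runs_increment ct o [::] v ok => //.
  by apply: contraTneq c_gt0 => v0; rewrite -size_v v0.
rewrite muln0 addn0 => H; apply: runs_bind; first exact: H.
apply: runs_bind; last exact: runs_ret.
by apply: (@runs_rewind_cat x s c k) => //; exact: size_embed.
Qed.

(** The test at [o - 1] tells whether a cell lies further left, that is, whether [o - 1] is a legal
    offset ([0] is not). The closing move to the right leads to [o - 1], or back to [1] when
    [o = 1]: this is the [maxn]. *)
Lemma runs_next_offset ct o : size ct = len -> 0 < o < k ->
  runs x (next_block false) (state ct o) (o == 1) (state ct (maxn o.-1 1)).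
Proof.
move=> size_ct ok; have kc : k <= k * c by rewrite leq_pmulr.
apply: runs_bind; first exact: runs_move_cat.
apply: runs_bind; first by apply: runs_detectL; rewrite size_ct /len /=; lia.
apply: runs_bind; first exact: runs_move_cat.
rewrite /mv size_ct ifT; last by rewrite /len; lia.
rewrite (_ : o == 1 = ~~ (0 < o.-1)); last by lia.
by rewrite (_ : maxn o.-1 1 = o.-2.+1); [exact: runs_ret | lia].
Qed.

Variables (good : seq bool -> bool) (b : bool).
Hypothesis M_spec : forall tau, size tau = c -> exists cf : config M,
  [/\ halts_in M x s tau cf, Defs.ct cf = tau &
      out cf = [:: if good tau then Some b else None]].

Lemma runs_search_success brute ct o v : 0 < o < k -> size v = c -> good v ->
  exists t, [/\ runs x (search M brute) (state (embed c k o ct v) o) tt t,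
                t_ct t = embed c k o ct v & t_out t = [:: Some b]].
Proof.
move=> ok size_v v_good; have [cf [halts ct_cf out_cf]] := M_spec size_v.
have [sim _] := @runs_simulate x s c k s_gt0 c_gt0 k_gt1 k_leN x_small M o ct ok v cf size_v halts.
eexists; split.
- apply: runs_loop_exit; apply: runs_bind; first exact: sim.
  rewrite /last_out out_cf v_good.
  by apply: runs_bind; [exact: runs_emit | exact: runs_ret].
- by rewrite /= ct_cf.
- by [].
Qed.

Lemma runs_search_failure brute brute' ct o v t t' : 0 < o < k -> size v = c ->
  ~~ good v ->
  runs x (next_block brute) (state (embed c k o ct v) o) brute' t' ->
  runs x (search M brute') t' tt t ->
  runs x (search M brute) (state (embed c k o ct v) o) tt t.
Proof.
move=> ok size_v v_bad next; have [cf [halts ct_cf out_cf]] := M_spec size_v.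
have [sim wf] := @runs_simulate x s c k s_gt0 c_gt0 k_gt1 k_leN x_small M o ct ok v cf size_v halts.
apply: runs_loop_next; apply: runs_bind; first exact: sim.
rewrite /last_out out_cf (negPf v_bad).
apply: runs_bind; first by apply: runs_reset.
by rewrite ct_cf; apply: runs_bind; [exact: next | exact: runs_ret].
Qed.

(** [n] only bounds the number of increments: the search stops at the first good content. *)
Lemma runs_search_brute ct v n : size v = c -> good (iter n inc v) ->
  exists t v', [/\ runs x (search M true) (state (embed c k 1 ct v) 1) tt t,
                t_ct t = embed c k 1 ct v' & t_out t = [:: Some b]].
Proof.
elim: n v => [|n IH] v size_v.
  by move=> v_good; have [t Ht] := @runs_search_success true ct 1 v k_gt1 size_v v_good;
    exists t, v.
rewrite iterSr => good_n; case: (boolP (good v)) => v_good.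
  by have [t Ht] := @runs_search_success true ct 1 v k_gt1 size_v v_good; exists t, v.
have [|t [v' [Ht ? ?]]] := IH (inc v) _ good_n; first by rewrite size_inc.
exists t, v'; split=> //.
by apply: runs_search_failure Ht => //; exact: runs_next_brute.
Qed.

(** The second alternative records what the error estimate needs: all blocks tried were bad, and
    only block [1] may have changed. *)
Lemma runs_search ct o : size ct = len -> 0 < o < k ->
  (exists2 v, size v = c & good v) ->
  exists t, [/\ runs x (search M false) (state ct o) tt t, t_out t = [:: Some b] &
    t_ct t = ct \/
    (forall o', 0 < o' <= o -> ~~ good (block o' ct)) /\
    exists v, t_ct t = embed c k 1 ct v].
Proof.
move=> size_ct ok [u size_u u_good]; elim: o ok => // o IH ok.
have size_b := size_block o.+1 ct; have ct_b := embed_block size_ct ok.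
case: (boolP (good (block o.+1 ct))) => [is_good|is_bad].
  have [t [Ht Hct Hout]] := runs_search_success false ct ok size_b is_good.
  by rewrite ct_b in Ht Hct; exists t; split=> //; left.
have fail t : runs x (search M (o.+1 == 1)) (state ct (maxn o 1)) tt t ->
    runs x (search M false) (state ct o.+1) tt t.
  rewrite -{2}ct_b; apply: runs_search_failure => //.
  by rewrite ct_b; exact: runs_next_offset.
case: o IH ok {size_b ct_b} is_bad fail => [|o] IH ok is_bad fail.
  have size_b := size_block 1 ct; have ct_b := @embed_block 1 ct size_ct k_gt1.
  have [n n_good] : exists n, iter n inc (block 1 ct) = u.
    by apply: inc_reaches; rewrite size_b.
  have [|t [v [Ht Hct Hout]]] := @runs_search_brute ct (block 1 ct) n size_b.
    by rewrite n_good.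
  rewrite ct_b in Ht; exists t; split=> //; first exact: fail.
  by right; split; [move=> [|[|o']] | exists v].
have [|t [Ht Hout Hct]] := IH; first by lia.
exists t; split=> //; first by apply: fail; rewrite (maxn_idPl _).
case: Hct => [|[bad ex]]; [by left | right; split=> // o' o'_le].
by case: (altP (o' =P o.+2)) => [->|o'_neq] //; apply: bad; lia.
Qed.

Lemma runs_machine L ct : size ct = len -> 1 < size x ->
  (exists2 v, size v = c & good v) ->
  exists t, [/\ runs x (machine L M) (Tapes 0 (nseq (6 * N) false) 0 ct 0 [::]) tt t,
    t_out t = [:: Some b] &
    t_ct t = ct \/
    (forall o, 0 < o < k -> ~~ good (block o ct)) /\
    exists v, t_ct t = embed c k 1 ct v].
Proof.
move=> size_ct x_gt1 ex_good.
have [|t [Ht Hout Hct]] := @runs_search ct k.-1 size_ct _ ex_good; first by lia.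
exists t; split=> //; last first.
  by case: Hct => [|[bad ex]]; [left | right; split=> // o ok; apply: bad; lia].
apply: runs_bind; first exact: runs_read_input.
rewrite /read_in ifT; last by lia.
apply: runs_bind; first exact: runs_move_input.
apply: runs_bind; first exact: runs_read_input.
rewrite /read_in /mv !ifT; try by lia.
apply: runs_bind; first exact: runs_move_input.
by apply: runs_bind; [apply: (@runs_initialize x s c k) | exact: Ht].
Qed.

End Search.

Lemma runs_machine_short L M x w ct : size x <= 1 ->
  runs x (machine L M) (Tapes 0 w 0 ct 0 [::]) tt
    (Tapes (size x) w 0 ct 0 [:: Some (L x)]).
Proof.
case: x => [|b [|]] // _.
  by apply: runs_bind; [exact: runs_read_input | exact: runs_emit].
apply: runs_bind; first exact: runs_read_input.
apply: runs_bind; first exact: runs_move_input.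
apply: runs_bind; first exact: runs_read_input.
exact: runs_emit.
Qed.

(** * The average error *)

Lemma double_ltn_exp t : 0 < t -> t.*2.+1 < 2 ^ t.+1.
Proof. by elim: t => // -[//|t] IH _; rewrite expnS; have := IH isT; lia. Qed.

(** One factor [2 ^ t] on the right absorbs [c]; what remains is [2 * t + 1 < 2 ^ (t + 1)]. *)
Lemma stride_bound t c : 0 < t -> c <= 2 ^ t -> t.*2.+1 * c < 2 ^ t.*2.+1.
Proof.
move=> t_gt0 ct; apply: (@leq_ltn_trans (t.*2.+1 * 2 ^ t)); first by rewrite leq_mul2l ct orbT.
rewrite (_ : t.*2.+1 = t.+1 + t) ?[in X in _ < X]expnD; last by lia.
rewrite ltn_pmul2r ?expn_gt0 // (_ : t.+1 + t = t.*2.+1); [exact: double_ltn_exp | lia].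
Qed.

Lemma stride_exists c : exists k, (1 < k) && (k * c < 2 ^ k).
Proof.
exists (c.+1).*2.+1; rewrite stride_bound //.
by apply/ltnW/(ltn_trans (ltn_expl c (isT : 1 < 2))); rewrite ltn_exp2l.
Qed.

(* The least [k] with [k * c < 2 ^ k] is also the number of binary digits of
   [k * c], so that the machine can compute it from the length [k * c + 1] of
   its catalytic tape. *)
Definition stride_length c := ex_minn (stride_exists c).

Lemma stride_length_gt1 c : 1 < stride_length c.
Proof. by rewrite /stride_length; case: ex_minnP => k /andP[]. Qed.

Lemma stride_length_lt c : stride_length c * c < 2 ^ stride_length c.
Proof. by rewrite /stride_length; case: ex_minnP => k /andP[]. Qed.

(** By minimality [k - 1] violates a condition: either [k = 2], and the bound reads [2 <= 2 * c], or
    [2 ^ (k - 1) <= (k - 1) * c]. *)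
Lemma stride_length_ge c : 0 < c -> 2 ^ (stride_length c).-1 <= stride_length c * c.
Proof.
rewrite /stride_length; case: ex_minnP => k /andP[k_gt1 _] k_min c_gt0.
case: (ltnP 2 k) => [k_gt2|]; last by move=> ?; have -> : k = 2; rewrite /=; lia.
have : ~~ ((1 < k.-1) && (k.-1 * c < 2 ^ k.-1)).
  by apply/negP => /k_min; lia.
by rewrite negb_and -!leqNgt => /orP[|H]; [lia | apply: leq_trans H _; rewrite leq_mul2r; lia].
Qed.

(** Serves twice: with [t = s] it makes [k] fit on the work tape, with [t] about [log c] it gives
    the space [O(c log c)]. *)
Lemma stride_length_le c t : 0 < t -> c <= 2 ^ t -> stride_length c <= t.*2.+1.
Proof.
move=> t_gt0 ct; rewrite /stride_length; case: ex_minnP => k _; apply.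
by rewrite stride_bound // andbT; lia.
Qed.

Lemma hammingE a b : size a = size b ->
  hamming a b = count (fun j => nth false a j != nth false b j) (iota 0 (size a)).
Proof.
move=> ab; rewrite /hamming.
have -> : zip a b = [seq (nth false a j, nth false b j) | j <- iota 0 (size a)].
  apply: (@eq_from_nth _ (false, false)); rewrite size_zip -ab minnn ?size_map ?size_iota //.
  by move=> j ja; rewrite nth_zip // (nth_map 0) ?size_iota // nth_iota.
by rewrite -map_comp count_map.
Qed.

Lemma hammingxx a : hamming a a = 0.
Proof.
by rewrite hammingE //; apply/eqP; rewrite -leqn0 leqNgt -has_count; apply/hasPn => j; rewrite eqxx.
Qed.

Lemma hamming_embed c k ct v : 1 < k -> size ct = (k * c).+1 ->
  hamming ct (embed c k 1 ct v) <= c.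
Proof.
move=> k_gt1 size_ct; rewrite hammingE ?size_embed // -size_filter.
apply: (@leq_trans (size [seq 1 + k * i | i <- iota 0 c])); last by rewrite size_map size_iota.
apply: uniq_leq_size; first by apply: filter_uniq; exact: iota_uniq.
move=> j; rewrite mem_filter mem_iota size_ct /= => /andP[].
move=> + jlt; rewrite nth_mkseq; last by lia.
case: (altP (j %% k =P 1)) => [Ej _|]; last by rewrite eqxx.
have jE : j = 1 + k * (j %/ k) by rewrite {1}(divn_eq j k) Ej addnC mulnC.
rewrite jE; apply: map_f; rewrite mem_iota /= -(@ltn_pmul2l k); last by lia.
by move: jlt; rewrite {1}jE; lia.
Qed.

(** * Counting the tapes on which all blocks fail *)

Section Counting.
Variables c k : nat.
Hypothesis k_gt1 : 1 < k.

Definition block_tuple c o (ct : seq bool) : c.-tuple bool :=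
  Tuple (introT eqP (size_block c k o ct)).

Definition bad_tapes (F : {set c.-tuple bool}) : {set (k * c).+1.-tuple bool} :=
  [set ct : (k * c).+1.-tuple bool | [forall o : 'I_k.-1, block_tuple c o.+1 ct \in F]].

(** A tape amounts to its [k - 1] blocks together with the [c + 1] cells of offset [0]; the blocks
    must lie in [F], the other cells are free. *)
Lemma card_bad_tapes F : #|bad_tapes F| <= #|F| ^ k.-1 * 2 ^ c.+1.
Proof.
pose split_blocks (ct : (k * c).+1.-tuple bool) :=
  ([ffun o : 'I_k.-1 => block_tuple c o.+1 ct], block_tuple c.+1 0 ct).
have split_inj : injective split_blocks.
  move=> a b E; have /ffunP E0 := congr1 fst E; have E1 := congr1 snd E; apply: eq_from_tnth => j.
  rewrite !(tnth_nth false); move: (j : nat) (ltn_ord j) => {}j jlt.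
  have jE := divn_eq j k; case: (posnP (j %% k)) => [j0|j_gt0].
    have := congr1 (fun t : c.+1.-tuple bool => nth false t (j %/ k)) E1.
    have jc : j %/ k < c.+1 by rewrite ltnS -(@leq_pmul2l k); lia.
    have jk : k * (j %/ k) = j by rewrite mulnC {2}jE j0 addn0.
    by rewrite /= !nth_mkseq // add0n jk.
  have ok : (j %% k).-1 < k.-1 by have := ltn_pmod j (ltnW k_gt1); lia.
  have := congr1 (fun t : c.-tuple bool => nth false t (j %/ k)) (E0 (Ordinal ok)).
  have jc : j %/ k < c by rewrite -(@ltn_pmul2l k); lia.
  have jk : j %% k + k * (j %/ k) = j by rewrite addnC mulnC -jE.
  by rewrite !ffunE /= !nth_mkseq // prednK // jk.
rewrite -(card_imset _ split_inj).
have -> : #|F| ^ k.-1 * 2 ^ c.+1 =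
    #|setX [set f : {ffun 'I_k.-1 -> c.-tuple bool} | f \in ffun_on (mem F)]
           [set: c.+1.-tuple bool]|.
  by rewrite cardsX cardsT card_tuple card_bool cardsE card_ffun_on card_ord.
apply: subset_leq_card; apply/subsetP => _ /imsetP[ct + ->].
rewrite !inE /= andbT => /forallP H.
by apply/ffun_onP => o; rewrite ffunE.
Qed.

Lemma card_bad_tapes_half (F : {set c.-tuple bool}) : 2 * #|F| <= 2 ^ c ->
  2 ^ k.-1 * #|bad_tapes F| <= 2 ^ (k * c).+1.
Proof.
move=> F_half; apply: (@leq_trans (2 ^ k.-1 * (#|F| ^ k.-1 * 2 ^ c.+1))).
  by rewrite leq_mul2l card_bad_tapes orbT.
rewrite mulnA -expnMn (_ : (k * c).+1 = c * k.-1 + c.+1); last first.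
  by case: k k_gt1 => // k' _; rewrite mulSn /= addnS mulnC addnC.
by rewrite expnD leq_mul2r expnM leq_exp2r ?F_half ?orbT //; lia.
Qed.

End Counting.

Lemma run_inj (M : TM) x m n (cf cf1 cf2 : config M) :
  run x m cf = Some cf1 -> run x n cf = Some cf2 -> cf1 = cf2.
Proof.
elim: m n cf => //= m IH [|n] cf //=; case: step => [cf'|]; first exact: IH.
by move=> [<-] [].
Qed.

Lemma halts_in_inj (M : TM) x w tau (cf1 cf2 : config M) :
  halts_in M x w tau cf1 -> halts_in M x w tau cf2 -> cf1 = cf2.
Proof. by move=> [m H1] [n H2]; apply: run_inj H1 H2. Qed.

(** The given set [S] need not contain all tapes with an answer; [G] is the set of all of them, and
    determinism puts [S] inside it. With [G] the output is known on every tape. *)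
Lemma half_good (M : TM) x (w c : nat) (b : bool) :
  (forall tau : c.-tuple bool, exists cf : config M,
     halts_in M x w tau cf /\ ct cf = tau /\ (out cf = [:: Some b] \/ out cf = [:: None])) ->
  (exists S : {set c.-tuple bool}, 2 ^ c <= 2 * #|S| /\
     forall tau, tau \in S -> exists cf : config M,
       halts_in M x w tau cf /\ out cf = [:: Some b]) ->
  exists2 G : {set c.-tuple bool}, 2 ^ c <= 2 * #|G| &
    forall tau : c.-tuple bool, exists cf : config M,
      [/\ halts_in M x w tau cf, ct cf = tau & out cf = [:: if tau \in G then Some b else None]].
Proof.
move=> halts [S [S_half S_good]].
have /fin_all_exists [g Hg] (tau : c.-tuple bool) : exists a : bool, exists cf : config M,
    [/\ halts_in M x w tau cf, ct cf = tau & out cf = [:: if a then Some b else None]].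
  have [cf [H1 [H2 [H3|H3]]]] := halts tau; first by exists true, cf.
  by exists false, cf.
exists [set tau | g tau]; last by move=> tau; rewrite inE; exact: Hg.
apply: leq_trans S_half _; rewrite leq_mul2l /=; apply: subset_leq_card.
apply/subsetP => tau tauS; rewrite inE.
have [cf1 [H1 H2]] := S_good tau tauS; have [cf2 [H3 _]] := Hg tau.
by rewrite -(halts_in_inj H1 H3) H2; case: (g tau).
Qed.

(** * The error bound tends to zero and bounds the average *)

Section Average.
Import Order.TTheory GRing.Theory Num.Theory.
Local Open Scope ring_scope.

Definition error (c : nat) : rat := c%:R / (2 ^ (stride_length c).-1)%:R.

Lemma error_ge0 c : 0 <= error c.
Proof. by rewrite /error divr_ge0 ?ler0n. Qed.

(** This is [k * c < 2 ^ k] divided by [2 ^ (k - 1)]. *)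
Lemma error_lt c : error c * (stride_length c)%:R < 2.
Proof.
rewrite /error mulrAC ltr_pdivrMr ?ltr0n ?expn_gt0 // -natrM -natrM ltr_nat.
have := stride_length_lt c; have := stride_length_gt1 c.
by case: stride_length => // k _; rewrite expnS mulnC.
Qed.

Lemma error_little_o (c : nat -> nat) :
  (forall n, trunc_log 2 n <= c n)%N -> little_o1 (fun n => error (c n)).
Proof.
(* For [n >= 2 ^ (2 ^ B)] one has [2 ^ B <= log n <= c n <= k * c n < 2 ^ k], so [2 / eps < B < k],
   and the error is below [2 / k < eps]. *)
move=> logc eps eps_gt0; pose B := Num.bound (2 / eps).
exists (2 ^ (2 ^ B))%N => n n_large; rewrite ger0_norm ?error_ge0 //.
have c_large : (2 ^ B <= c n)%N.
  by apply: leq_trans (logc n); rewrite -(@trunc_expnK 2 (2 ^ B)) //; exact: leq_trunc_log.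
have k_large : (B < stride_length (c n))%N.
  rewrite -(@ltn_exp2l 2) //; apply: leq_ltn_trans (stride_length_lt (c n)).
  by apply: leq_trans c_large _; rewrite leq_pmull // (ltnW (stride_length_gt1 _)).
have B_gt : 2 / eps < B%:R by apply: archi_boundP; rewrite divr_ge0 // ltW.
have k_gt0 : 0 < (stride_length (c n))%:R :> rat by rewrite ltr0n; apply: leq_trans k_large.
rewrite -(ler_pM2r k_gt0); apply: le_trans (ltW (error_lt _)) _.
rewrite mulrC -ler_pdivrMr //; apply: le_trans (ltW B_gt) _.
by rewrite ler_nat ltnW.
Qed.

Lemma average_le (c m : nat) (bad : {set m.-tuple bool}) (d : m.-tuple bool -> nat) :
  (forall tau, d tau <= if tau \in bad then c else 0)%N ->
  (2 ^ (stride_length c).-1 * #|bad| <= 2 ^ m)%N ->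
  (\sum_(tau : m.-tuple bool) (d tau)%:R) / (2 ^ m)%:R <= error c.
Proof.
move=> d_le bad_le; rewrite -natr_sum /error.
rewrite ler_pdivrMr ?ltr0n ?expn_gt0 // mulrAC ler_pdivlMr ?ltr0n ?expn_gt0 //.
rewrite -!natrM ler_nat; apply: (@leq_trans (c * #|bad| * 2 ^ (stride_length c).-1)%N).
  rewrite leq_mul2r; apply/orP; right.
  apply: (@leq_trans (\sum_(tau : m.-tuple bool) if tau \in bad then c else 0)%N).
    by apply: leq_sum => tau _.
  by rewrite -big_mkcond sum_nat_const mulnC.
by rewrite -mulnA leq_mul2l (mulnC #|bad|) bad_le orbT.
Qed.

End Average.

Theorem theorem6p5 (s c : nat -> nat) :
  nondecreasing_nat s -> nondecreasing_nat c ->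
  logspace_constructible s -> logspace_constructible c ->
  (forall n, trunc_log 2 n <= s n) ->
  (forall n, s n <= c n) -> (forall n, c n <= 2 ^ s n) ->
  forall L : seq bool -> bool,
    ZPtauCSPACE s c L ->
    exists (s' c' : nat -> nat) (e : nat -> rat),
      bigO s' s /\ bigO c' (fun n => c n * trunc_log 2 (c n)) /\
      little_o1 e /\ AVGtauLCSPACE s' c' e L.
Proof.
move=> _ _ _ _ logs sc cs L [M M_spec].
have s_gt0 n : 1 < n -> 0 < s n.
  by move=> n_gt1; apply: leq_trans (logs n); rewrite trunc_log_gt0.
exists (fun n => 6 * (s n).*2.+1), (fun n => (stride_length (c n) * c n).+1),
  (fun n => error (c n)); split; [|split; [|split]].
(* [6 * (2 * s + 1) <= 18 * s] as soon as [s >= 1]. *)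
- by exists 18, 2 => n /s_gt0; lia.
(* For [n >= 4] the logarithm [t] of [c] is at least 1, so [k <= 2 * (t + 1) + 1 <= 5 * t]; the
   sixth unit pays for the extra cell. *)
- exists 6, 4 => n n_ge4.
  have c_gt1 : 1 < c n.
    apply: leq_trans (sc n); apply: leq_trans (logs n).
    by rewrite -(@trunc_expnK 2 2) //; exact: leq_trunc_log.
  have t_gt0 : 0 < trunc_log 2 (c n) by rewrite trunc_log_gt0.
  have := @stride_length_le (c n) (trunc_log 2 (c n)).+1 isT (ltnW (trunc_log_ltn _ (isT : 1 < 2))).
  set t := trunc_log 2 (c n) in t_gt0 *; move=> k_le.
  have k_le5 : stride_length (c n) <= 5 * t by lia.
  apply: (@leq_ltn_trans (5 * t * c n)); first by rewrite leq_mul2r k_le5 orbT.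
  by rewrite (mulnC (c n)) mulnA ltn_pmul2r; lia.
- by apply: error_little_o => n; apply: leq_trans (sc n).
exists (compile (machine L M)) => x; set n := size x.
case: (ltnP 1 n) => [n_gt1|n_le1]; last first.
  exists val; split=> [tau|].
    by eexists; split; [apply: compile_halts; exact: runs_machine_short | ].
  rewrite big1 ?GRing.mul0r ?error_ge0 // => tau _.
  by rewrite hammingxx.
have [halts good_half] := M_spec x.
have [G G_half G_spec] := half_good halts good_half.
have c_gt0 : 0 < c n by apply: leq_trans (sc n); exact: s_gt0.
have k_gt1 := stride_length_gt1 (c n).
set k := stride_length (c n) in k_gt1 *.
have k_bits : 2 ^ k.-1 <= k * c n < 2 ^ k by rewrite stride_length_ge ?stride_length_lt.
have k_leN : k <= (s n).*2.+1 by apply: stride_length_le; [exact: s_gt0 | exact: cs].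
have x_small : size x < 2 ^ (s n).*2.+1.
  apply: leq_trans (trunc_log_ltn _ (isT : 1 < 2)) _; rewrite leq_exp2l //.
  by have := logs n; rewrite -/n; lia.
(* Extends membership in [G] to sequences, which the search handles; other lengths count as bad. *)
pose good (v : seq bool) := if insub v is Some tau then tau \in G else false.
have good_val (tau : (c n).-tuple bool) : good tau = (tau \in G) by rewrite /good valK.
have good_spec tau : size tau = c n -> exists cf : config M,
    [/\ halts_in M x (s n) tau cf, ct cf = tau & out cf = [:: if good tau then Some (L x) else None]].
  move=> /eqP size_tau; have [cf Hcf] := G_spec (Tuple size_tau).
  by exists cf; rewrite -good_val in Hcf.
have ex_good : exists2 v, size v = c n & good v.
  have : 0 < #|G| by move: G_half; rewrite -/n; have := expn_gt0 2 (c n); lia.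
  by case/card_gt0P => tau tauG; exists tau; [rewrite size_tuple | rewrite good_val].
have /fin_all_exists [f Hf] (tau : (k * c n).+1.-tuple bool) : exists tau' : seq bool,
   (exists cf : config (compile (machine L M)),
      halts_in (compile (machine L M)) x (6 * (s n).*2.+1) tau cf /\
      out cf = [:: Some (L x)] /\ ct cf = tau') /\
   hamming tau tau' <= if tau \in bad_tapes k (~: G) then c n else 0.
  have [t [Ht Hout Hct]] := runs_machine (s_gt0 n n_gt1) c_gt0 k_gt1 k_leN k_bits x_small
    good_spec L (size_tuple tau) n_gt1 ex_good.
  exists (t_ct t); split.
    by exists (config_of None t); split; [exact: compile_halts | ].
  (* If the tape may have changed, all its blocks lie in the complement of [G], and only the [c n]
     cells of block [1] can differ. *)
  case: Hct => [->|[bad [v ->]]]; first by rewrite hammingxx.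
  rewrite inE ifT; first by rewrite hamming_embed ?size_tuple.
  apply/forallP => o; rewrite inE.
  have ok : 0 < o.+1 < k by have := ltn_ord o; lia.
  by have := bad _ ok; rewrite -[block _ _ _ _]/(val (block_tuple k (c n) o.+1 tau)) good_val.
exists f; split=> [tau|]; first by have [] := Hf tau.
apply: (@average_le (c n) _ (bad_tapes k (~: G))) => [tau|]; first by have [] := Hf tau.
apply: card_bad_tapes_half => //.
have := cardsC G; rewrite card_tuple card_bool -/n in G_half *; lia.
Qed.
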